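(* Let $0<\epsilon_1\le \epsilon_2<\infty$, let $f$ be a probability density on $S=[0,1]^2$ with $\epsilon_1\le f(x)\le \epsilon_2$ for all $x\in S$, and let $F_c$ be the complementary cumulative distribution function of a positive random variable. For sequences $(r_n)$, $(p_n)$ with $0<r_n<1$, $0<p_n<1$, let $G=G(r_n)$ be the Bernoulli random geometric graph on $\{1,\dots,n\}$ with location density $f$, adjacency distance $r_n$, edge probability $p_n$ and i.i.d. edge weights with ccdf $F_c$; let $\tau_n$ be the maximum weight of a spanning tree of the largest component of $G$; let $E_{con}$ be the event that $G$ is connected; and for $z>0$ let $H(z)=\sup\{x>0: F_c(x)\ge 1/z\}$ (all as specified in the context). (a) There are constants $\gamma_0,\gamma_1>0$ such that for every constant $M>\gamma_0$ and all sequences $(r_n),(p_n)$ with $0<r_n<1$, $0<p_n<1$ satisfying $nr_n^2p_n\ge M\log n$ for all sufficiently large $n$, we have, for all sufficiently large $n$, $$\mathbb{P}\left(E_{con}\cap\left\{\tau_n\ge \gamma_1 n H(\gamma_1 n r_n^2p_n)\right\}\right)\ge 1-e^{-\gamma_1 n r_n^2p_n}$$ and $\mathbb{E}\tau_n\ge \gamma_1 n H(\gamma_1 n r_n^2p_n)$. (b) Suppose in addition that there are constants $C,x_0>0$ and $s>2$ such that $$F_c(ax)\le \frac{C}{a^s}F_c(x)\quad\text{for all } a>1 \text{ and } x>x_0.$$ Then there are constants $\gamma_2,\gamma_3>0$ such that for every constant $M>\gamma_2$ and all sequences $(r_n),(p_n)$ with $0<r_n<1$, $0<p_n<1$ satisfying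 $nr_n^2p_n\ge M\log n$ for all sufficiently large $n$, we have, for all sufficiently large $n$, $$\mathbb{P}\left(E_{con}\cap\left\{\tau_n\le \gamma_2 n H(n r_n^2p_n)\right\}\right)\ge 1-\frac{1}{(n^2r_n^2p_n)^{\gamma_3}}$$ and $\mathbb{E}\tau_n\le \gamma_2 n H(n r_n^2p_n)$.
   Context: Setting. $K_n$ is the complete graph on vertex set $\{1,\dots,n\}$. For each $n$, the following three families are independent of each other: (i) the edge states $\{Z(e)\}_{e\in K_n}$, i.i.d. Bernoulli with $\mathbb{P}(Z(e)=1)=p_n=1-\mathbb{P}(Z(e)=0)$; (ii) the edge weights $\{W(e)\}_{e\in K_n}$, i.i.d. positive random variables with complementary cumulative distribution function (ccdf) $F_c(x)=\mathbb{P}(W(e)>x)$, $x>0$, where $F_c$ does not depend on $n$; (iii) the vertex locations $X_1,\dots,X_n$, i.i.d. in $S=[0,1]^2$ with density $f$. The Bernoulli random geometric graph $G=G(r_n)$ with adjacency distance $r_n$ and edge probability $p_n$ is the random subgraph of $K_n$ on vertex set $\{1,\dots,n\}$ whose edges are all $(u,v)$ with $d(X_u,X_v)<r_n$ and $Z(u,v)=1$, where $d$ is Euclidean distance. A tree is a connected acyclic subgraph of $G$; its weight is the sum of $W(e)$ over its edges $e$. A spanning tree of a component $\mathcal{C}$ of $G$ is a tree in $\mathcal{C}$ containing all vertices of $\mathcal{C}$. $\tau_n$ is the maximum weight of a spanning tree of the largest component (most vertices; ties broken by any fixed rule) of $G$. Constants do not depend on $n$. *)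

(* Defs.v *)
From HB Require Import structures.
From mathcomp Require Import all_boot all_order all_algebra.
From mathcomp Require Import all_classical all_reals all_analysis.
Import Order.TTheory GRing.Theory Num.Theory.
Import numFieldNormedType.Exports.

Set Implicit Arguments.
Unset Strict Implicit.
Unset Printing Implicit Defensive.

Local Open Scope classical_set_scope.
Local Open Scope ring_scope.

(* The edges of the complete graph K_n on 'I_n: an unordered pair is
   represented by its increasing ordering. *)
Definition edge (n : nat) := {e : 'I_n * 'I_n | (e.1 < e.2)%N}.

Section Graphs.
Variable n : nat.
Implicit Types (E : {set edge n}) (V : {set 'I_n}).

Definition adj E : rel 'I_n :=
  [rel u v | [exists e in E, (val e == (u, v)) || (val e == (v, u))]].

Definition connected_on V E : Prop :=
  {in V &, forall u v, connect (adj E) u v}.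

Definition acyclic E : Prop :=
  forall c : seq 'I_n, (2 < size c)%N -> ~ ucycle (adj E) c.

(* The graph (V, E) is a tree. *)
Definition is_tree V E : Prop :=
  [/\ {in E, forall e, (val e).1 \in V /\ (val e).2 \in V},
      V != finset.set0, connected_on V E & acyclic E].

(* C is the vertex set of a connected component of the graph with vertex set
   'I_n and edge set E. *)
Definition is_component E (C : {set 'I_n}) : Prop :=
  exists x : 'I_n, C = [set y | connect (adj E) x y]%SET.

Definition is_largest_component E (C : {set 'I_n}) : Prop :=
  is_component E C /\
  forall C' : {set 'I_n}, is_component E C' -> (#|C'| <= #|C|)%N.

Definition spanning_tree E (C : {set 'I_n}) (A : {set edge n}) : Prop :=
  A \subset E /\ is_tree C A.

End Graphs.

(* A way of breaking ties: it designates, in every graph with at least one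
   vertex, one of the components with the most vertices. *)
Definition tie_breaking_rule
    (rule : forall n : nat, {set edge n} -> {set 'I_n}) : Prop :=
  forall (n : nat) (E : {set edge n}),
    (0 < n)%N -> is_largest_component E (rule n E).

Section Probability.
Context {d : measure_display} {T : measurableType d} {R : realType}.
Variable P : probability T R.
Context {d' : measure_display} {T' : measurableType d'}.

Definition mutually_independent (I : finType) (Y : I -> T -> T') : Prop :=
  forall A : I -> set T', (forall i, measurable (A i)) ->
    P (\bigcap_i (Y i @^-1` A i)) = (\prod_(i : I) P (Y i @^-1` A i))%E.

Definition sigma_of (I : Type) (Y : I -> T -> T') : set (set T) :=
  <<s \bigcup_i preimage_set_system setT (Y i) measurable >>.

End Probability.

Definition positive_with_ccdf (R : realType) (d : measure_display)
    (T : measurableType d) (P : probability T R) (Y : {RV P >-> R})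
    (Fc : R -> R) : Prop :=
  (forall w, 0 < Y w) /\ (forall x, 0 < x -> ccdf Y x = (Fc x)%:E).

Definition is_positive_ccdf (R : realType) (Fc : R -> R) : Prop :=
  exists (d : measure_display) (T : measurableType d) (P : probability T R)
    (Y : {RV P >-> R}), positive_with_ccdf Y Fc.

(* Lebesgue measure is canonically a measure on [measurableTypeR R], an alias
   of R that carries the Borel sigma-algebra. *)
Definition plane (R : realType) : Type :=
  (measurableTypeR R * measurableTypeR R)%type.
HB.instance Definition _ (R : realType) := Measurable.copy (plane R)
  (measurableTypeR R * measurableTypeR R)%type.

Definition lebesgue2 (R : realType) : {measure set (plane R) -> \bar R} :=
  (@lebesgue_measure R \x @lebesgue_measure R)%E.
Arguments lebesgue2 : clear implicits.

Definition unit_square (R : realType) : set (plane R) :=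
  [set x | 0 <= (x.1 : R) <= 1 /\ 0 <= (x.2 : R) <= 1].
Arguments unit_square : clear implicits.

Definition square_density (R : realType) (f : plane R -> R) : Prop :=
  [/\ measurable_fun (unit_square R) f,
      (forall x, unit_square R x -> 0 <= f x) &
      (\int[lebesgue2 R]_(x in unit_square R) (f x)%:E = 1)%E].

Definition has_square_density (R : realType) (d : measure_display)
    (T : measurableType d) (P : probability T R) (Y : {RV P >-> plane R})
    (f : plane R -> R) : Prop :=
  forall A : set (plane R), measurable A ->
    distribution P Y A =
    (\int[lebesgue2 R]_(x in A `&` unit_square R) (f x)%:E)%E.

(* A probability space carrying the edge states, the edge weights and the
   vertex locations for one value of n. *)
Record brgg_space (R : realType) (f : plane R -> R) (Fc : R -> R) (n : nat)
    (p : R) := BrggSpace {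
  brgg_disp : measure_display;
  sample : measurableType brgg_disp;
  prob : probability sample R;
  edge_state : edge n -> {RV prob >-> bool};
  edge_weight : edge n -> {RV prob >-> R};
  location : 'I_n -> {RV prob >-> plane R};
  Z_law : forall e, prob (edge_state e @^-1` [set true]) = p%:E;
  W_law : forall e, positive_with_ccdf (edge_weight e) Fc;
  X_law : forall i, has_square_density (location i) f;
  Z_indep : mutually_independent prob (fun e => edge_state e : sample -> bool);
  W_indep : mutually_independent prob (fun e => edge_weight e : sample -> R);
  X_indep : mutually_independent prob (fun i => location i : sample -> plane R);
  ZWX_indep : forall A B D : set sample,
    sigma_of (fun e => edge_state e : sample -> bool) A ->
    sigma_of (fun e => edge_weight e : sample -> R) B ->
    sigma_of (fun i => location i : sample -> plane R) D ->
    prob (A `&` B `&` D) = (prob A * prob B * prob D)%E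
}.

(* The canonical norm on a product is the sup norm. *)
Definition euclid_dist (R : realType) (x y : plane R) : R :=
  Num.sqrt ((x.1 - y.1 : R) ^+ 2 + (x.2 - y.2 : R) ^+ 2).

Section RandomGraph.
Context {R : realType} {f : plane R -> R} {Fc : R -> R} {n : nat} {p : R}.
Variables (B : brgg_space f Fc n p) (r : R).

Definition brgg (w : sample B) : {set edge n} :=
  [set e : edge n |
    (euclid_dist (location B (val e).1 w) (location B (val e).2 w) < r) &&
    edge_state B e w]%SET.

Definition E_con : set (sample B) :=
  [set w | connected_on [set: 'I_n]%SET (brgg w)].

Definition weight (A : {set edge n}) (w : sample B) : R :=
  \sum_(e in A) edge_weight B e w.

(* Every component has a spanning tree and weights are nonnegative, so the
   default value 0 of the maximum plays no role when 0 < n. *)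
Definition tau (rule : forall n : nat, {set edge n} -> {set 'I_n})
    (w : sample B) : R :=
  \big[Num.max/0]_(A : {set edge n}
      | `[< spanning_tree (brgg w) (rule n (brgg w)) A >]) weight A w.

End RandomGraph.
Arguments tau {R f Fc n p} B r rule w.
Arguments E_con {R f Fc n p} B r _ : rename.

(* When Fc is the ccdf of a positive random variable, this set is bounded for
   every z > 0 and nonempty for every z > 1. *)
Definition H (R : realType) (Fc : R -> R) (z : R) : R :=
  sup [set x : R | 0 < x /\ z^-1 <= Fc x].

(* Main.v *)
(* Let D = n r^2 p, the order of the mean degree. Cut the square into K x K cells with
   3/r < K <= 4/r, so that points of neighbouring cells are adjacent up to the edge state,
   and points at distance less than r are at most 5 cells apart. All laws are then
   discretized: locations to cells, weights to threshold levels.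

   Connectivity: by a Chernoff bound every cell receives order n r^2 points; given that,
   the union of two neighbouring cells carries a dense Erdos-Renyi graph, disconnected with
   probability of order n e^(-cD).

   Lower bound: keep the open edges of weight above h = H(g1 D)/2, which have probability at
   least 1/(g1 n r^2). By pigeonhole any set of n/2 vertices contains order n^2 r^2 pairs in
   a common cell, whatever the locations, so it spans no heavy edge with probability at most
   e^(-Cn/g1), which beats the 2^n choices of the set. Hence over half of the vertices meet
   a heavy edge, and a forest of at least n/4 heavy edges extends to a spanning tree.

   Upper bound: let b be a large multiple of h = H(D). A forest has at most n edges, so tau
   is at most n b plus the total weight of the edges of G heavier than b. There are order
   n D edges, each heavy with probability at most 1/D, and the tail condition with s > 2
   bounds E[W^2; W > b] by O(b^2/D): Chebyshev's inequality gives an error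
   of order 1/n, and a dyadic layer decomposition gives the expectation. *)
Require Import Defs.
From HB Require Import structures.
From mathcomp Require Import all_boot all_order all_algebra.
From mathcomp Require Import all_classical all_reals all_analysis.
From mathcomp Require Import measurable_realfun.
From mathcomp Require Import ring lra zify.
Import Order.TTheory GRing.Theory Num.Theory.
Import numFieldNormedType.Exports.
Local Open Scope classical_set_scope.
Local Open Scope ring_scope.
Set Implicit Arguments.
Unset Strict Implicit.
Unset Printing Implicit Defensive.

(** * Forests *)

(** After [prob_obs] an event is a predicate on a cell map and an edge labelling, both finite, and
    conditioning on the locations means fixing the first argument. Neither the graph nor [tau] is a
    function of these data, so bad events of the finite model are only required to contain the
    failures: [model_graph_sub] and [brgg_far] enclose the graph from both sides. The hypothesis on
    M enters only through ln n <= c D and through D being large, with c a fixed multiple of eps1;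
    this is why the constants do not depend on M. A bound in probability says nothing about [tau] on
    the exceptional event, where weights may be unbounded. The upper bound on the expectation
    therefore has its own argument: it is linear in the edges, averages over the locations instead
    of excluding crowded cells, and uses infinitely many weight levels, whereas Chebyshev's
    inequality is applied to finitely many levels with fixed cells. *)

Section Forests.
Variable n : nat.
Implicit Types (A E : {set edge n}).

Lemma adjP E (u v : 'I_n) :
  reflect (exists2 e, e \in E & val e = (u, v) \/ val e = (v, u)) (adj E u v).
Proof.
apply: (iffP existsP) => [[e /andP[eE /orP[]/eqP h]]|[e eE h]].
- by exists e => //; left.
- by exists e => //; right.
- by exists e; rewrite eE /=; case: h => ->; rewrite eqxx ?orbT.
Qed.

Lemma adj_sym E : symmetric (adj E).
Proof. by move=> u v; apply/adjP/adjP => -[e eE h]; exists e => //; case: h; auto. Qed.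

Lemma connect_adjC E : connect_sym (adj E).
Proof. exact/sym_connect_sym/adj_sym. Qed.

Lemma connect_adjS A E : A \subset E ->
  forall u v, connect (adj A) u v -> connect (adj E) u v.
Proof.
move=> /fintype.subsetP AE u v; apply: connect_sub => x y /adjP[e eA h].
by apply/connect1/adjP; exists e => //; apply: AE.
Qed.

Lemma adj_val E e : e \in E -> adj E (val e).1 (val e).2.
Proof. by move=> eE; apply/adjP; exists e => //; left; case: (val e). Qed.

Lemma adjU1 E e u v : adj (e |: E)%SET u v ->
  adj E u v \/ val e = (u, v) \/ val e = (v, u).
Proof.
move=> /adjP[e']; rewrite !inE => /orP[/eqP ->|e'E] h; first by right.
by left; apply/adjP; exists e'.
Qed.

Lemma acyclicS A E : A \subset E -> acyclic E -> acyclic A.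
Proof.
move=> /fintype.subsetP AE Eac c c2 /andP[cA uc]; apply: (Eac c c2); rewrite /ucycle uc andbT.
apply: sub_cycle cA => x y /adjP[e eA h].
by apply/adjP; exists e => //; apply: AE.
Qed.

Lemma acyclic0 : acyclic (finset.set0 : {set edge n}).
Proof.
move=> [|x c]//= _ /andP[]; rewrite /= rcons_path; case: c => [|y c] /=.
  by case/adjP => e; rewrite inE.
by case/andP => /andP[/adjP[e]]; rewrite inE.
Qed.

(* A cycle through the new edge e is e followed by a path of A joining its ends. *)
Lemma acyclicU1 A e : acyclic A -> ~~ connect (adj A) (val e).1 (val e).2 ->
  acyclic (e |: A)%SET.
Proof.
move=> Aac nxy c c2 /andP[cc uc].
have nuv u v : val e = (u, v) \/ val e = (v, u) -> ~~ connect (adj A) u v.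
  by case=> h; move: nxy; rewrite h //= connect_adjC.
have [a [ac nadj]] : exists a, a \in c /\ ~~ adj A a (next c a).
  apply: contrapT => h; apply: (Aac c c2); rewrite /ucycle uc andbT.
  apply: cycle_from_next => // a ac; apply: contrapT => /negP na.
  by apply: h; exists a.
have [i c' ec] := rot_to ac.
rewrite -(next_rot i) // ec in nadj.
rewrite -(rot_cycle i) ec in cc; rewrite -(rot_uniq i) ec in uc.
rewrite -(size_rot i) ec /= in c2.
case: c' c2 cc uc nadj {ec} => [//|b [//|d c']] _.
rewrite /= eqxx rcons_path => /and4P[/adjU1[h|hab] bd dp la] uc nadj.
  by rewrite h in nadj.
move: uc; rewrite !inE !negb_or => /and3P[/and3P[ab ad ac'] /andP[bd' bc'] _].
have in_A x y : x != a -> y != a -> adj (e |: A)%SET x y -> adj A x y.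
  move=> xa ya /adjU1[//|h]; case: h hab => -> [] [ex ey]; subst;
  by rewrite ?eqxx in xa, ya.
have in_A' x y : x != b -> y != b -> adj (e |: A)%SET x y -> adj A x y.
  move=> xb yb /adjU1[//|h]; case: h hab => -> [] [ex ey]; subst;
  by rewrite ?eqxx in xb, yb.
have {}bd : adj A b d by apply: in_A => //; rewrite eq_sym.
have {}dp : path (adj A) d c'.
  have dNa : all (predC1 a) (d :: c').
    by rewrite /= eq_sym ad /=; apply/allP => z zc; apply: contra ac' => /eqP <-.
  by apply: (sub_in_path _ dNa dp) => x y; rewrite !inE => xa ya; apply: in_A.
have {}la : adj A (last d c') a.
  apply: in_A' => //; move: (mem_last d c'); rewrite inE => /orP[/eqP ->|lc] //.
  - by rewrite eq_sym.
  - by apply: contra bc' => /eqP <-.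
have : connect (adj A) b a.
  by apply/connectP; exists (d :: rcons c' a); rewrite /= ?last_rcons// rcons_path bd dp.
have : ~~ connect (adj A) a b by apply: nuv.
by rewrite connect_adjC => /negbTE ->.
Qed.

(** Take a maximal acyclic set between [A0] and [E]: by [acyclicU1], an edge of [E] joining two of
    its components could still be added. *)
Lemma spanning_forest A0 E : A0 \subset E -> acyclic A0 ->
  exists A : {set edge n}, [/\ A0 \subset A, A \subset E, acyclic A &
    forall u v, connect (adj E) u v -> connect (adj A) u v].
Proof.
move=> A0E ac0.
have [A /maxsetP[/andP[AE /asboolP Aac] Amax] A0A] :=
  @maxset_exists _ (fun A => (A \subset E) && `[< acyclic A >]) A0
    ltac:(by rewrite /= A0E; apply/asboolP).
exists A; split => // u v; apply: connect_sub => x y xy.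
suff h e : e \in E -> connect (adj A) (val e).1 (val e).2.
  by case/adjP: xy => e /h; move=> + [] ve; rewrite ve // connect_adjC.
move=> eE; apply: contrapT => /negP ne.
have /Amax : (e |: A \subset E)%SET && `[< acyclic (e |: A)%SET >].
  rewrite finset.subUset finset.sub1set eE AE; apply/asboolP; exact: acyclicU1.
move=> /(_ (finset.subsetUr _ _)) eA; case/negP: ne.
by apply/connect1/adj_val; rewrite -eA finset.setU11.
Qed.

Lemma spanning_tree_extend A0 E : (0 < n)%N -> A0 \subset E -> acyclic A0 ->
  connected_on [set: 'I_n]%SET E ->
  exists2 A : {set edge n}, A0 \subset A & spanning_tree E [set: 'I_n]%SET A.
Proof.
move=> n0 A0E ac0 Ec; have [A [A0A AE Aac Acon]] := spanning_forest A0E ac0.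
exists A => //; split => //; split => //.
- by apply/set0Pn; exists (Ordinal n0); rewrite inE.
- by move=> u v uT vT; apply/Acon/Ec.
Qed.

Lemma spanning_forest_degree E : exists A : {set edge n}, [/\ A \subset E, acyclic A &
  forall u, (exists v, adj E u v) -> exists v, adj A u v].
Proof.
have [A [_ AE Aac Acon]] := spanning_forest (finset.sub0set E) acyclic0.
exists A; split => // u [v uv].
have uNv : u != v.
  case/adjP: uv => e _ h; have := valP e; apply: contraL => /eqP uv.
  by case: h => ->; rewrite uv /= ltnn.
have /connectP[[|w q] /= ] := Acon _ _ (connect1 uv).
  by move=> _ vu; rewrite vu eqxx in uNv.
by case/andP=> uw _ _; exists w.
Qed.

Lemma leq_card_cover A (U : {set 'I_n}) :
  (forall u, u \in U -> exists v, adj A u v) -> (#|U| <= 2 * #|A|)%N.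
Proof.
move=> UA.
have /subset_leq_card : U \subset ([set (val e).1 | e in A] :|: [set (val e).2 | e in A])%SET.
  apply/fintype.subsetP => u /UA[v /adjP[e eA h]]; rewrite inE.
  by apply/orP; case: h => ve; [left|right]; apply/imsetP; exists e; rewrite ?ve.
move/leq_trans; apply; apply: leq_trans (leq_card_setU _ _) _.
by rewrite mul2n -addnn leq_add// leq_imset_card.
Qed.

(* l labels the components of the forest; adding an edge merges two labels. *)
Lemma leq_card_acyclic A : acyclic A -> (#|A| <= n)%N.
Proof.
move=> Aac.
suff [l [_]] : exists l : 'I_n -> 'I_n,
    (forall u v, l u = l v -> connect (adj A) u v) /\
    (#|[set l u | u in 'I_n]%SET| + #|A| <= n)%N by lia.
move: {2}#|A| (erefl #|A|) => k; elim: k A Aac => [|k IH] A Aac cA.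
  exists id; split => [u v ->|]; first exact: connect0.
  by rewrite cA addn0 (leq_trans (max_card _)) // card_ord.
have [e eA] : exists e, e \in A by apply/card_gt0P; rewrite cA.
set A' := (A :\ e)%SET.
have A'A : A' \subset A := finset.subD1set _ _.
have cA' : #|A'| = k by move: cA; rewrite (cardsD1 e) eA => -[].
have [l [lc lk]] := IH _ (acyclicS A'A Aac) cA'.
set x := (val e).1; set y := (val e).2.
have xy : adj A x y := adj_val eA.
(* Otherwise a simple path from x to y avoids e. With two or more edges it closes up with e to a
   cycle; a single edge would be e itself or its reversal, which the ordering of the ends
   excludes. *)
have nxy : l x <> l y.
  move/lc => /connectP[p pp ey].
  case/shortenP: pp ey => {}p pp up _ ey.
  case: p pp up ey => [|z [|z' p]] /=.
  - by move=> _ _ exy; have := valP e; rewrite -/x -/y exy ltnn.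
  - rewrite andbT => /adjP[e' + h] _ ezy; subst z.
    rewrite !inE => /andP[e'e _]; case: h => ve'.
      by case/eqP: e'e; apply: val_inj; rewrite ve' /x /y; case: (val e).
    have := valP e; have := valP e'; rewrite ve' /=.
    rewrite -/x -/y; lia.
  - move=> pp up ey; apply: (Aac [:: x, z, z' & p]) => //.
    apply/andP; split => //; rewrite /cycle.
    have : path (adj A') x [:: z, z' & p] by [].
    move/(sub_path (e' := adj A)) => h.
    rewrite rcons_path h /=; last first.
      by move=> a b /adjP[e' e'A h']; apply/adjP; exists e' => //; apply: (fintype.subsetP A'A).
    by rewrite -ey adj_sym.
pose l' u := if l u == l x then l y else l u.
exists l'; split.
  have cS := connect_adjS A'A.
  have cyx : connect (adj A) y x by rewrite connect_adjC connect1.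
  move=> u v; rewrite /l'; case: eqP => [ux|_]; case: eqP => [vx|_].
  - by move=> _; apply/cS/lc; rewrite ux vx.
  - move=> yv; apply: connect_trans (cS _ _ (lc _ _ ux)) _.
    by apply: connect_trans (connect1 xy) _; apply/cS/lc.
  - move=> uy; apply: connect_trans (cS _ _ (lc _ _ uy)) _.
    by apply: connect_trans cyx _; apply/cS/lc.
  - by move/lc/cS.
apply: leq_trans lk; rewrite cA cA' addnS -addSn leq_add2r.
apply: proper_card; apply/properP; split.
  apply/fintype.subsetP => _ /imsetP[u _ ->]; rewrite /l'.
  by case: ifP => _; apply: imset_f.
exists (l x); first exact: imset_f.
apply/imsetP => -[u _]; rewrite /l'; case: eqP => [_|ux xu]; first exact: nxy.
by apply: ux.
Qed.

End Forests.

(** * Product laws on finite functions *)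

Section FiniteProduct.
Variables (R : realType) (I A : finType) (mu : I -> A -> R).
Implicit Types (F G : {ffun I -> A} -> R).

Definition Ex F : R := \sum_(b : {ffun I -> A}) (\prod_i mu i (b i)) * F b.

Lemma eq_Ex F G : F =1 G -> Ex F = Ex G.
Proof. by move=> FG; apply: eq_bigr => b _; rewrite FG. Qed.

Lemma ExD F G : Ex (fun b => F b + G b) = Ex F + Ex G.
Proof. by rewrite /Ex -big_split/=; apply: eq_bigr => b _; rewrite mulrDr. Qed.

Lemma ExZ c F : Ex (fun b => c * F b) = c * Ex F.
Proof. by rewrite /Ex mulr_sumr; apply: eq_bigr => b _; rewrite mulrCA. Qed.

Lemma Ex_sum (J : finType) (P : pred J) (F : J -> {ffun I -> A} -> R) :
  Ex (fun b => \sum_(j | P j) F j b) = \sum_(j | P j) Ex (F j).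
Proof. by rewrite /Ex exchange_big/=; apply: eq_bigr => b _; rewrite mulr_sumr. Qed.

Lemma Ex_prod (g : I -> A -> R) :
  Ex (fun b => \prod_i g i (b i)) = \prod_i \sum_a mu i a * g i a.
Proof. by rewrite bigA_distr_bigA; apply: eq_bigr => b _; rewrite big_split. Qed.

Hypothesis mu_ge0 : forall i a, 0 <= mu i a.
Hypothesis mu1 : forall i, \sum_a mu i a = 1.

Lemma le_Ex F G : (forall b, F b <= G b) -> Ex F <= Ex G.
Proof. by move=> FG; apply: ler_sum => b _; rewrite ler_wpM2l// prodr_ge0. Qed.

Lemma Ex_cst c : Ex (fun=> c) = c.
Proof.
suff Ex1 : Ex (fun=> 1) = 1.
  by rewrite -[RHS]mulr1 -[in RHS]Ex1 -ExZ; apply: eq_Ex => b; rewrite mulr1.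
pose g (i : I) (a : A) : R := 1.
transitivity (Ex (fun b => \prod_i g i (b i))).
  by apply: eq_Ex => b; rewrite big1.
rewrite Ex_prod big1// => i _; rewrite -[RHS](mu1 i).
by apply: eq_bigr => a _; rewrite mulr1.
Qed.

(** Padding with factors 1 gives a full product, to which [Ex_prod] applies. This yields the
    vanishing covariances in [Ex_chebyshev] and the independence of two locations in [Ex_close]. *)
Lemma Ex_coord2 i j (Y : I -> A -> R) : i != j ->
  Ex (fun b => Y i (b i) * Y j (b j)) =
  (\sum_a mu i a * Y i a) * (\sum_a mu j a * Y j a).
Proof.
move=> ij.
pose g k a : R := (if k == i then Y k a else 1) * (if k == j then Y k a else 1).
have prod1 k0 (f : I -> R) : \prod_k (if k == k0 then f k else 1) = f k0.
  by rewrite -big_mkcond big_pred1_eq.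
transitivity (Ex (fun b => \prod_k g k (b k))).
  apply: eq_Ex => b; rewrite big_split/=.
  by rewrite (prod1 i (fun k => Y k (b k))) (prod1 j (fun k => Y k (b k))).
rewrite Ex_prod.
pose m k := \sum_a mu k a * Y k a.
rewrite -/(m i) -/(m j) -(prod1 i m) -(prod1 j m) -big_split/=.
apply: eq_bigr => k _; rewrite /g /m; case: (eqVneq k i) => [->|ki].
  rewrite (negbTE ij) mulr1; apply: eq_bigr => a _; by rewrite mulr1.
case: eqVneq => _; rewrite mul1r.
  by apply: eq_bigr => a _; rewrite mul1r.
by rewrite -[RHS](mu1 k); apply: eq_bigr => a _; rewrite !mulr1.
Qed.

Lemma Ex_coord i (Y : A -> R) : Ex (fun b => Y (b i)) = \sum_a mu i a * Y a.
Proof.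
pose g k a : R := if k == i then Y a else 1.
transitivity (Ex (fun b => \prod_k g k (b k))).
  by apply: eq_Ex => b; rewrite /g -big_mkcond big_pred1_eq.
rewrite Ex_prod (bigD1 i)//= /g eqxx [X in _ * X]big1 ?mulr1// => k /negbTE ->.
by rewrite -[RHS](mu1 k); apply: eq_bigr => a _; rewrite mulr1.
Qed.

Lemma Ex_forall (D : {set I}) (g : I -> pred A) :
  Ex (fun b => [forall i in D, g i (b i)]%:R) =
  \prod_(i in D) \sum_(a | g i a) mu i a.
Proof.
pose h i a : R := ((i \in D) ==> g i a)%:R.
transitivity (Ex (fun b => \prod_i h i (b i))).
  apply: eq_Ex => b; case: forallP => [gb|/forallP].
    by rewrite big1// => i _; rewrite /h gb.
  by rewrite negb_forall => /existsP[i /negbTE gi]; rewrite (bigD1 i)//= /h gi mul0r.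
rewrite Ex_prod [RHS]big_mkcond; apply: eq_bigr => i _; rewrite /h; case: ifP => iD /=.
  by rewrite [RHS]big_mkcond; apply: eq_bigr => a _; case: (g i a); rewrite ?mulr1 ?mulr0.
by rewrite -[RHS](mu1 i); apply: eq_bigr => a _; rewrite mulr1.
Qed.

Lemma Ex_avoid (D : {set I}) (g : pred A) x :
  (forall i, i \in D -> x <= \sum_(a | g a) mu i a) ->
  Ex (fun b => [forall i in D, ~~ g (b i)]%:R) <= expR (- (x * #|D|%:R)).
Proof.
move=> hx; rewrite (Ex_forall D (fun _ a => ~~ g a)).
rewrite -mulNr mulrC expRM_natl -prodr_const.
apply: ler_prod => i iD; rewrite sumr_ge0//=.
have := mu1 i; rewrite (bigID g)/= => h.
have := expR_ge1Dx (- x); have := hx _ iD; lra.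
Qed.

Lemma Ex_exists (J : finType) (P : J -> {ffun I -> A} -> bool) :
  Ex (fun b => [exists j, P j b]%:R) <= \sum_j Ex (fun b => (P j b)%:R).
Proof.
rewrite -Ex_sum; apply: le_Ex => b; case: existsP => [[j Pj]|_].
  by rewrite (bigD1 j)//= Pj lerDl sumr_ge0.
by rewrite sumr_ge0.
Qed.

(** One-sided Chebyshev inequality: after centring, the cross terms vanish, and the raw second
    moment [s] dominates each variance. *)
Lemma Ex_chebyshev (D : {set I}) (Y : I -> A -> R) (s t v : R) : 0 < v ->
  (forall i, i \in D -> \sum_a mu i a * Y i a ^+ 2 <= s) ->
  \sum_(i in D) \sum_a mu i a * Y i a <= t ->
  Ex (fun b => (t + v < \sum_(i in D) Y i (b i))%R%:R) <= #|D|%:R * s / v ^+ 2.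
Proof.
move=> v0 hs ht.
pose m i := \sum_a mu i a * Y i a.
pose Y' i a := Y i a - m i.
have v20 : 0 < v ^+ 2 by rewrite exprn_gt0.
have Y'0 i : \sum_a mu i a * Y' i a = 0.
  rewrite /Y'; under eq_bigr do rewrite mulrBr.
  by rewrite sumrB -mulr_suml mu1 mul1r subrr.
have Y'2 i : i \in D -> \sum_a mu i a * Y' i a ^+ 2 <= s.
  move=> iD; apply: le_trans (hs _ iD); rewrite -subr_ge0.
  rewrite -sumrB (_ : \sum_i0 _ = \sum_a mu i a * Y i a * (2 * m i) - \sum_a mu i a * m i ^+ 2).
    by rewrite -!mulr_suml mu1 -/(m i); have := sqr_ge0 (m i); lra.
  by rewrite -sumrB; apply: eq_bigr => a _; rewrite /Y'; ring.
rewrite ler_pdivlMr// mulrC -ExZ.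
apply: (@le_trans _ _ (Ex (fun b => \sum_(i in D) \sum_(j in D) Y' i (b i) * Y' j (b j)))).
  apply: le_Ex => b; rewrite -big_distrlr/= -expr2.
  case: ltP => [h|_]; last by rewrite mulr0 sqr_ge0.
  have {}h : v <= \sum_(i in D) Y' i (b i) by rewrite sumrB; move: ht h; rewrite /m; lra.
  by rewrite mulr1 ler_pXn2r ?nnegrE ?(ltW v0)//; apply: le_trans h; apply: ltW.
rewrite Ex_sum mulr_natl -sumr_const; apply: ler_sum => i iD.
rewrite Ex_sum (bigD1 i)//= [X in _ + X]big1 ?addr0 => [|j /andP[_ ji]].
  rewrite (Ex_coord i (fun a => Y' i a * Y' i a)); exact: Y'2.
by rewrite Ex_coord2 1?eq_sym// Y'0 mul0r.
Qed.

Definition count_at (a : A) (b : {ffun I -> A}) : R := #|[set i | b i == a]%SET|%:R.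

Lemma Ex_exp_count (a : A) (c : R) :
  Ex (fun b => expR (c * count_at a b)) =
  \prod_i (1 + mu i a * (expR c - 1)).
Proof.
pose g (i : I) a' : R := if a' == a then expR c else 1.
transitivity (Ex (fun b => \prod_i g i (b i))).
  apply: eq_Ex => b; rewrite /count_at mulrC expRM_natl -prodr_const.
  by rewrite big_mkcond/=; apply: eq_bigr => i _; rewrite inE.
rewrite Ex_prod; apply: eq_bigr => i _; rewrite /g.
rewrite (bigD1 a)//= eqxx (eq_bigr (mu i)) => [|a' /negbTE ->]; last by rewrite mulr1.
by have := mu1 i; rewrite (bigD1 a)//= => h; lra.
Qed.

(** Chernoff bound with parameter -1: since e^(-1) <= 1/2, each factor is at most 1 - mu/2 <=
    e^(-q/2). *)
Lemma Ex_count_lt (a : A) (q m : R) : (forall i, q <= mu i a) ->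
  Ex (fun b => (count_at a b < m)%R%:R) <= expR (m - q * #|I|%:R / 2).
Proof.
move=> hq; have em1 : expR (- 1) <= 2^-1 :> R.
  by rewrite expRN lef_pV2 ?posrE ?expR_gt0//; have := expR_ge1Dx (1 : R); lra.
apply: (@le_trans _ _ (Ex (fun b => expR m * expR (- 1 * count_at a b)))).
  apply: le_Ex => b; case: ltP => [h|_]; last by rewrite mulr_ge0 ?expR_ge0.
  by rewrite -expRD -[leLHS]expR0 ler_expR; lra.
rewrite ExZ expRD ler_pM2l ?expR_gt0// Ex_exp_count.
rewrite (_ : - (q * #|I|%:R / 2) = (- (q / 2)) * #|I|%:R); last by field.
rewrite mulrC expRM_natl -prodr_const.
apply: ler_prod => i _.
have mu_le1 : mu i a <= 1 by rewrite -[leRHS](mu1 i) (bigD1 a)//= lerDl sumr_ge0.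
have e0 := expR_ge0 (- 1 : R).
apply/andP; split; first by have := mu_ge0 i a; nra.
apply: le_trans (expR_ge1Dx _); have := hq i; have := mu_ge0 i a; nra.
Qed.

(** Chernoff bound with parameter 1: since e <= 4, each factor is at most 1 + 3 mu <= e^(3q). *)
Lemma Ex_count_gt (a : A) (q m : R) : (forall i, mu i a <= q) ->
  Ex (fun b => (m < count_at a b)%R%:R) <= expR (3 * q * #|I|%:R - m).
Proof.
move=> hq; have e4 : expR 1 <= 4 :> R.
  have e2 : expR (2^-1) <= 2 :> R.
    rewrite -[leRHS]invrK -[leLHS]invrK lef_pV2 ?posrE ?invr_gt0 ?expR_gt0// -expRN.
    by have := expR_ge1Dx (- 2^-1 : R); lra.
  rewrite (_ : 1 = 2^-1 + 2^-1 :> R); last by field.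
  by rewrite expRD; have := expR_ge0 (2^-1 : R); nra.
have e1 : 1 <= expR 1 :> R by have := expR_ge1Dx (1 : R); lra.
apply: (@le_trans _ _ (Ex (fun b => expR (- m) * expR (1 * count_at a b)))).
  apply: le_Ex => b; case: ltP => [h|_]; last by rewrite mulr_ge0 ?expR_ge0.
  by rewrite -expRD -[leLHS]expR0 ler_expR; lra.
rewrite ExZ addrC expRD ler_pM2l ?expR_gt0// Ex_exp_count.
rewrite mulrC expRM_natl -prodr_const.
apply: ler_prod => i _; have m0 := mu_ge0 i a.
apply/andP; split; first by nra.
apply: le_trans (expR_ge1Dx _); have := hq i; nra.
Qed.

End FiniteProduct.

Section SubsetSums.
Variables (R : realType) (T : finType).

Lemma sum_exp_card (x : R) : \sum_(S : {set T}) x ^+ #|S| = (1 + x) ^+ #|T|.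
Proof.
rewrite -prodr_const (eq_bigl xpredT)// addrC bigA_distr; apply: eq_bigr => S _.
by rewrite -big_mkcond/= prodr_const.
Qed.

(** With y = |T| x <= 1/2, (1 + x)^|T| <= e^y <= 1/(1 - y) <= 1 + 2y. *)
Lemma sum_exp_card_neq0 (x : R) : 0 <= x -> #|T|%:R * x <= 2^-1 ->
  \sum_(S : {set T} | S != finset.set0) x ^+ #|S| <= 2 * #|T|%:R * x.
Proof.
move=> x0 hx; have := sum_exp_card x; rewrite (bigD1 finset.set0)//= cards0 expr0.
move=> h; suff : (1 + x) ^+ #|T| <= 1 + 2 * #|T|%:R * x by lra.
have y0 : 0 <= #|T|%:R * x by rewrite mulr_ge0.
apply: (@le_trans _ _ (expR (#|T|%:R * x))).
  by rewrite expRM_natl lerXn2r ?nnegrE ?expR_ge0 ?expR_ge1Dx//; lra.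
have /= := expR_ge1Dx (- (#|T|%:R * x)); rewrite expRN => e1.
have e0 := expR_gt0 (#|T|%:R * x).
move: e1; rewrite -(ler_pM2r e0) mulVf ?gt_eqF//.
move: (expR _) e0 => e e0; nra.
Qed.

End SubsetSums.

(** * Cuts, grids and the discrete model *)

Section Cuts.
Variable n : nat.
Implicit Types (S V : {set 'I_n}) (E : {set edge n}).

Lemma edge_between (u v : 'I_n) : u != v ->
  exists e : edge n, val e = (u, v) \/ val e = (v, u).
Proof.
move=> uv; case: (ltngtP u v) => h.
- by exists (exist _ (u, v) h); left.
- by exists (exist _ (v, u) h); right.
- by case/eqP: uv; apply: val_inj.
Qed.

Definition cut S V : {set edge n} :=
  [set e | (((val e).1 \in S) && ((val e).2 \in V)) ||
           (((val e).2 \in S) && ((val e).1 \in V))]%SET.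

Lemma leq_card_cut S V : [disjoint S & V]%B -> (#|S| * #|V| <= #|cut S V|)%N.
Proof.
move=> dSV; rewrite -cardsX.
pose f (e : edge n) := if (val e).1 \in S then val e else ((val e).2, (val e).1).
suff /subset_leq_card/leq_trans : finset.setX S V \subset [set f e | e in cut S V]%SET.
  by apply; apply: leq_imset_card.
apply/fintype.subsetP => -[u v]; rewrite inE/= => /andP[uS vV].
have nvS : v \notin S by apply: contraL dSV => vS; apply/pred0Pn; exists v; rewrite /= vS.
have [|e he] := @edge_between u v; first by apply: contraNneq nvS => <-.
apply/imsetP; exists e.
  by rewrite inE; case: he => ->; rewrite /= uS vV ?orbT.
by rewrite /f; case: he => ->; rewrite /= ?uS ?(negbTE nvS).
Qed.

Lemma cut_adj E S V e : e \in E -> e \in cut S V ->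
  exists u v, [/\ u \in S, v \in V & adj E u v].
Proof.
move=> eE; rewrite inE => /orP[]/andP[h1 h2].
  by exists (val e).1, (val e).2; split => //; apply: adj_val.
by exists (val e).2, (val e).1; split => //; rewrite adj_sym; apply: adj_val.
Qed.

(** If u does not reach v, both the set reached from u and its complement in V are uncrossed. The
    smaller of the two is tested; keeping |S| at most half of |V| makes the cut at least |S| |V| / 2
    large. *)
Lemma connected_on_cut E V :
  (forall S, S != finset.set0 -> S \subset V -> (2 * #|S| <= #|V|)%N ->
     exists2 e, e \in E & e \in cut S (V :\: S)) ->
  connected_on V E.
Proof.
move=> hcut u v uV vV; apply: contrapT => /negP nuv.
pose A := [set y in V | connect (adj E) u y]%SET.
have closedA x y : x \in V -> y \in V -> adj E x y -> (x \in A) = (y \in A).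
  move=> xV yV xy; rewrite !inE xV yV /=; apply/idP/idP => h.
    by apply: connect_trans h (connect1 xy).
  by apply: connect_trans h _; rewrite connect_adjC connect1.
have AV : A \subset V by apply/fintype.subsetP => y; rewrite inE => /andP[].
have key S : S = A \/ S = V :\: A -> (2 * #|S| <= #|V|)%N -> False.
  move=> SA S2.
  have SV : S \subset V by case: SA => ->//; apply: finset.subsetDl.
  have S0 : S != finset.set0.
    apply/set0Pn; case: SA => ->; first by exists u; rewrite inE uV connect0.
    by exists v; rewrite !inE vV (negbTE nuv).
  have [e eE /(cut_adj eE)[x [y [xS]]]] := hcut S S0 SV S2.
  rewrite inE => /andP[yS yV xy].
  have := closedA _ _ (fintype.subsetP SV _ xS) yV xy.
  move: xS yS; case: SA => ->; first by move=> -> /negbTE ->.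
  by rewrite !finset.in_setD yV andbT negbK => /andP[/negbTE -> _] ->.
have cA : (#|A| + #|V :\: A| = #|V|)%N by rewrite -(cardsID A V) (finset.setIidPr AV).
have [|hA] := leqP (2 * #|A|) #|V|; first by apply: key; left.
by apply: (key (V :\: A)%SET); [right|lia].
Qed.

(* A maximal forest of the heavy graph E' covers every vertex that is not isolated in
   E', hence more than half of them; it extends to a spanning tree. *)
Lemma heavy_spanning_tree (R : realType) (E E' : {set edge n}) (W : edge n -> R) h :
  (0 < n)%N -> E' \subset E -> connected_on [set: 'I_n]%SET E ->
  (forall V, (n <= 2 * #|V|)%N ->
     exists e, [/\ e \in E', (val e).1 \in V & (val e).2 \in V]) ->
  0 <= h -> (forall e, 0 <= W e) -> (forall e, e \in E' -> h <= W e) ->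
  exists2 A, spanning_tree E [set: 'I_n]%SET A & n%:R * h / 4 <= \sum_(e in A) W e.
Proof.
move=> n0 E'E Ec hV h0 W0 hW.
have [A0 [A0E' A0ac A0deg]] := spanning_forest_degree E'.
have [A A0A At] := spanning_tree_extend n0 (fintype.subset_trans A0E' E'E) A0ac Ec.
exists A => //.
pose U := [set u : 'I_n | [exists v, adj E' u v]]%SET.
have cU : (#|U| <= 2 * #|A0|)%N.
  by apply: leq_card_cover => u; rewrite inE => /existsP uv; apply: A0deg.
(* The vertices outside [U] span no edge of [E'], so by [hV] they are fewer than half. *)
have nU : (n <= 2 * #|U|)%N.
  have := cardsC U; rewrite card_ord => cU'.
  have [/hV[e [eE']]|] := leqP n (2 * #|~: U|%SET); last by lia.
  by rewrite !inE => /existsPn /(_ (val e).2); rewrite adj_val.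
have {cU nU} : (n%:R <= 4 * #|A0|%:R :> R) by rewrite -natrM ler_nat; lia.
have : #|A0|%:R * h <= \sum_(e in A) W e.
  rewrite (big_setID A0)/= (finset.setIidPr A0A) mulr_natl -sumr_const.
  rewrite -[leLHS]addr0 lerD ?sumr_ge0// ler_sum// => e /(fintype.subsetP A0E').
  exact: hW.
move: (#|A0|%:R) (n%:R) => a b; nra.
Qed.

End Cuts.

(** * Cells of the grid and connectivity from cell to cell *)

Section Grid.
Variable k : nat.
Definition cell := ('I_k.+1 * 'I_k.+1)%type.

Definition close (l : nat) (c d : cell) : bool :=
  [&& (c.1 <= d.1 + l)%N, (d.1 <= c.1 + l)%N, (c.2 <= d.2 + l)%N & (d.2 <= c.2 + l)%N].

Lemma closeC l c d : close l c d = close l d c.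
Proof. by rewrite /close; apply/and4P/and4P => -[]. Qed.

Lemma card_close l c : (#|[set d | close l c d]%SET| <= (2 * l + 1) ^ 2)%N.
Proof.
pose f (d : cell) : 'I_(2 * l).+1 * 'I_(2 * l).+1 :=
  (inord (d.1 + l - c.1), inord (d.2 + l - c.2)).
rewrite -(@card_in_imset _ _ f).
  by apply: leq_trans (max_card _) _; rewrite card_prod !card_ord addn1 -mulnn.
move=> [d1 d2] [e1 e2]; rewrite !inE /close /= => /and4P[? ? ? ?] /and4P[? ? ? ?].
move=> [/(congr1 val) + /(congr1 val)]; rewrite /= !inordK; try lia.
by move=> h1 h2; congr (_, _); apply: val_inj; rewrite /=; lia.
Qed.

Variable n : nat.
Implicit Types (kap : {ffun 'I_n -> cell}) (E : {set edge n}).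

Definition block kap (c d : cell) : {set 'I_n} := [set u | (kap u == c) || (kap u == d)]%SET.

(** Every cell is linked to the corner by stepping to the truncated predecessor in both coordinates;
    nonempty cells make the links transitive. *)
Lemma grid_connected kap E : (forall c, exists u, kap u = c) ->
  (forall c d, close 1 c d -> connected_on (block kap c d) E) ->
  connected_on [set: 'I_n]%SET E.
Proof.
move=> hne hcon.
pose lnk c d := forall u v, kap u = c -> kap v = d -> connect (adj E) u v.
have lnk_close c d : close 1 c d -> lnk c d.
  by move=> cd u v uc vd; apply: (hcon c d cd); rewrite inE ?uc ?vd eqxx ?orbT.
have lnk_trans c d e : lnk c d -> lnk d e -> lnk c e.
  have [w wd] := hne d.
  by move=> cd de u v uc ve; apply: connect_trans (cd u w uc wd) (de w v wd ve).
have lnk0 c : lnk c (ord0, ord0).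
  move: {2}(c.1 + c.2)%N (leqnn (c.1 + c.2)) => m.
  elim: m c => [|m IH] [i j] /= hm.
    have -> : i = ord0 by apply: val_inj => /=; lia.
    have -> : j = ord0 by apply: val_inj => /=; lia.
    by apply: lnk_close; rewrite /close /=; lia.
  pose i' : 'I_k.+1 := inord i.-1; pose j' : 'I_k.+1 := inord j.-1.
  have ei : val i' = i.-1 by rewrite /= inordK//; have := ltn_ord i; lia.
  have ej : val j' = j.-1 by rewrite /= inordK//; have := ltn_ord j; lia.
  have [le_m|lt_m] := leqP (i + j)%N m; first exact: IH.
  apply: (lnk_trans _ (i', j')).
    by apply: lnk_close; rewrite /close /=; rewrite /= in ei ej; lia.
  by apply: IH; rewrite /=; rewrite /= in ei ej; lia.
move=> u v _ _.
have [z zP] := hne (ord0, ord0).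
have h w : connect (adj E) w z by apply: lnk0 zP.
by apply: connect_trans (h u) _; rewrite connect_adjC.
Qed.

End Grid.

(** * Edge counts and union bounds for fixed cells *)

Section FiniteModel.
Variables (R : realType) (n k : nat) (F : finType).
Implicit Types (kap : {ffun 'I_n -> cell k}) (bet : {ffun edge n -> bool * F}).

(* Adjacency is decided by the cells alone; at the scale of the grid this is a subgraph
   of the random geometric graph. *)
Definition model_graph kap bet : {set edge n} :=
  [set e | close 1 (kap (val e).1) (kap (val e).2) && (bet e).1]%SET.

Definition same_cell kap (U : {set 'I_n}) : {set edge n} :=
  [set e | [&& (val e).1 \in U, (val e).2 \in U & kap (val e).1 == kap (val e).2]]%SET.

Definition far_edges (l : nat) kap : {set edge n} :=
  [set e | close l (kap (val e).1) (kap (val e).2)]%SET.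

Lemma sum_count_at kap (U : {set 'I_n}) (w : cell k -> R) :
  \sum_(u in U) w (kap u) = \sum_c w c * #|[set u in U | kap u == c]%SET|%:R.
Proof.
rewrite (partition_big kap xpredT)//=; apply: eq_bigr => c _.
rewrite mulr_natr -sumr_const; apply: eq_big => [u|u /andP[_ /eqP ->]//].
by rewrite inE.
Qed.

(* Pigeonhole: N^2 >= 2 a N - a^2 for the occupation numbers N, with a = n / (2 K). *)
Lemma card_same_cell kap (U : {set 'I_n}) : (n <= 2 * #|U|)%N ->
  n%:R ^+ 2 / (8 * #|{: cell k}|%:R) - n%:R / 2 <= #|same_cell kap U|%:R :> R.
Proof.
move=> nU; set K := #|{: cell k}|%:R : R.
have K0 : 0 < K by rewrite ltr0n card_prod card_ord.
pose N c : R := #|[set u in U | kap u == c]%SET|%:R.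
pose pairs := [set uv : 'I_n * 'I_n | [&& uv.1 \in U, uv.2 \in U & kap uv.1 == kap uv.2]]%SET.
have pairsE : #|pairs|%:R = \sum_c N c ^+ 2.
  rewrite (eq_bigr (fun c => N c * #|[set u in U | kap u == c]%SET|%:R)); last by move=> c _; rewrite expr2.
  rewrite -sum_count_at /N -natr_sum; congr (_%:R).
  rewrite -sum1_card (eq_bigl (fun uv => (uv.1 \in U) && ((uv.2 \in U) && (kap uv.2 == kap uv.1)))); last first.
    by move=> uv; rewrite inE (eq_sym (kap uv.1)).
  rewrite -(pair_big_dep (mem U) (fun u v => (v \in U) && (kap v == kap u)) (fun _ _ => 1%N))/=.
  apply: eq_bigr => u _; rewrite -sum1_card; apply: eq_bigl => v.
  by rewrite inE.
(* An edge accounts for two ordered pairs and the diagonal for at most n; hence the loss n/2. *)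
have pairs_le : (#|pairs| <= 2 * #|same_cell kap U| + n)%N.
  have sub : pairs \subset ([set val e | e in same_cell kap U] :|:
     [set ((val e).2, (val e).1) | e in same_cell kap U] :|: [set (u, u) | u in 'I_n])%SET.
    apply/fintype.subsetP => -[u v]; rewrite !inE /= => /and3P[uU vU /eqP uv].
    have [->|neq] := eqVneq u v; first by rewrite imset_f ?orbT.
    have [e he] := edge_between neq.
    by case: he => ve; [apply/orP; left; apply/orP; left|apply/orP; left; apply/orP; right];
      apply/imsetP; exists e; rewrite ?inE ?ve ?uU ?vU ?uv ?eqxx.
  have := subset_leq_card sub.
  have [h1 _] := leq_card_setU ([set val e | e in same_cell kap U] :|:
     [set ((val e).2, (val e).1) | e in same_cell kap U])%SET [set (u, u) | u in 'I_n]%SET.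
  have [h2 _] := leq_card_setU ([set val e | e in same_cell kap U])%SET
     [set ((val e).2, (val e).1) | e in same_cell kap U]%SET.
  have h3 := leq_imset_card (fun e : edge n => val e) (same_cell kap U).
  have h4 := leq_imset_card (fun e : edge n => ((val e).2, (val e).1)) (same_cell kap U).
  have h5 := leq_imset_card (fun u : 'I_n => (u, u)) 'I_n.
  rewrite card_ord in h5. move=> h0; apply: (leq_trans h0); apply: (leq_trans h1).
  by rewrite leq_add// (leq_trans h2)// mul2n -addnn leq_add.
have cU : \sum_c N c = #|U|%:R.
  rewrite -[RHS]mulr1 mulr_natl -sumr_const (sum_count_at kap U (fun=> 1)).
  by apply: eq_bigr => c _; rewrite mul1r.
pose a : R := n%:R / (2 * K).
have : \sum_c N c ^+ 2 >= \sum_c (2 * a * N c - a ^+ 2).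
  by apply: ler_sum => c _; have := sqr_ge0 (N c - a); nra.
rewrite sumrB -mulr_sumr cU -pairsE sumr_const -/(cell k) -[_ *+ _]mulr_natr -/K.
have : n%:R <= 2 * #|U|%:R :> R by rewrite -natrM ler_nat.
have : #|pairs|%:R <= 2 * #|same_cell kap U|%:R + n%:R :> R by rewrite -natrM -natrD ler_nat.
have -> : n%:R ^+ 2 / (8 * K) = a ^+ 2 * K / 2 by rewrite /a; field; rewrite gt_eqF.
have en : n%:R = 2 * a * K by rewrite /a; field; rewrite gt_eqF.
have a0 : 0 <= a by rewrite divr_ge0 ?ler0n// mulr_ge0// ltW.
rewrite en; move: (#|pairs|%:R) (#|same_cell kap U|%:R) (#|U|%:R : R) => x y z h1 h2 h3.
have := ler_wpM2l a0 h2; nra.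
Qed.

Lemma card_far_edges l kap (m : R) : (forall c, count_at R c kap <= m) ->
  #|far_edges l kap|%:R <= n%:R * (((2 * l + 1) ^ 2)%:R * m).
Proof.
move=> hm.
have m0 : 0 <= m by apply: le_trans (hm (ord0, ord0)); rewrite ler0n.
pose near := [set uv : 'I_n * 'I_n | close l (kap uv.1) (kap uv.2)]%SET.
have le1 : (#|far_edges l kap| <= #|near|)%N.
  rewrite -(card_imset _ (@val_inj _ _ (edge n))); apply: subset_leq_card.
  by apply/fintype.subsetP => _ /imsetP[e + ->]; rewrite !inE.
apply: (@le_trans _ _ #|near|%:R); first by rewrite ler_nat.
have -> : #|near|%:R = \sum_(u : 'I_n) \sum_(v : 'I_n | close l (kap u) (kap v)) 1 :> R.
  by rewrite pair_big_dep/= -sumr_const; apply: eq_bigl => uv; rewrite inE.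
apply: (@le_trans _ _ (\sum_(u : 'I_n) ((2 * l + 1) ^ 2)%:R * m)); last first.
  by rewrite sumr_const card_ord -[leLHS]mulr_natl.
apply: ler_sum => u _.
rewrite (partition_big kap (close l (kap u)))//=.
apply: (@le_trans _ _ (\sum_(c | close l (kap u) c) m)).
  apply: ler_sum => c cu; apply: le_trans (hm c).
  rewrite /count_at -sumr_const le_eqVlt; apply/orP; left; apply/eqP.
  by apply: eq_bigl => v; rewrite inE; case: eqP => [->|]; rewrite ?andbF// cu.
rewrite sumr_const -[leLHS]mulr_natl ler_wpM2r// ler_nat -[X in (X <= _)%N]cardsE.
exact: card_close.
Qed.

Variable mu : edge n -> bool * F -> R.
Hypothesis mu_ge0 : forall e a, 0 <= mu e a.
Hypothesis mu1 : forall e, \sum_a mu e a = 1.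

(* By grid_connected a disconnection yields a cut of two neighbouring cells, with small
   side S and at least |S| m / 2 closed pairs across it. *)
Lemma Ex_disconnected kap (p m : R) : 0 <= p -> 0 < m ->
  (forall e, p <= \sum_(a | a.1) mu e a) ->
  (forall c, m <= count_at R c kap) ->
  n%:R * expR (- (p * m / 2)) <= 2^-1 ->
  Ex mu (fun bet => (~~ `[< connected_on [set: 'I_n]%SET (model_graph kap bet) >])%:R) <=
  #|{: cell k}|%:R ^+ 2 * (2 * n%:R * expR (- (p * m / 2))).
Proof.
move=> p0 m0 hp hm nx; set x := expR _.
pose cond (c d : cell k) (S : {set 'I_n}) :=
  [&& close 1 c d, S != finset.set0, S \subset block kap c d &
      (2 * #|S| <= #|block kap c d|)%N].
pose sep (c d : cell k) (S : {set 'I_n}) bet :=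
  [forall e in cut S (block kap c d :\: S)%SET, ~~ (bet e).1].
pose bad (j : cell k * cell k * {set 'I_n}) bet :=
  cond j.1.1 j.1.2 j.2 && sep j.1.1 j.1.2 j.2 bet.
apply: (@le_trans _ _ (Ex mu (fun bet => [exists j, bad j bet]%:R))).
  apply: le_Ex => // bet; rewrite ler_nat; case: asboolP => //= ncon.
  case: existsP => //= nbad; exfalso; apply: ncon.
  apply: grid_connected => [c|c d cd].
    have := lt_le_trans m0 (hm c); rewrite ltr0n => /card_gt0P[u].
    by rewrite inE => cu; exists u; apply: (eqP cu).
  apply: connected_on_cut => S S0 SV S2.
  have /negP : ~ bad (c, d, S) bet by move=> b; apply: nbad; exists (c, d, S).
  rewrite /bad /cond /= cd S0 SV S2 /= /sep negb_forall => /existsP[e].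
  rewrite negb_imply negbK => /andP[ec eb]; exists e => //.
  rewrite inE eb andbT.
  have hb u : u \in block kap c d -> kap u = c \/ kap u = d.
    by rewrite inE => /orP[]/eqP; auto.
  have [/hb h1 /hb h2] : (val e).1 \in block kap c d /\ (val e).2 \in block kap c d.
    move: ec; rewrite inE !finset.in_setD.
    by move=> /orP[]/andP[/(fintype.subsetP SV) -> /andP[_ ->]]; rewrite ?orbT.
  by case: h1 => ->; case: h2 => ->; rewrite // ?(closeC _ d c)//; rewrite /close; lia.
apply: le_trans (Ex_exists mu_ge0 _) _.
rewrite -(pair_big xpredT xpredT (fun cd S => Ex mu (fun bet => (bad (cd, S) bet)%:R)))/=.
have -> : #|{: cell k}|%:R ^+ 2 * (2 * n%:R * x) = \sum_(cd : cell k * cell k) 2 * n%:R * x.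
  by rewrite sumr_const -[RHS]mulr_natl (card_prod (cell k) (cell k)) natrM expr2.
apply: ler_sum => -[c d] _.
have x0 : 0 <= x by rewrite expR_ge0.
(* The decay x^|S| pays for the number of sets S: the union costs 2 n x and not 2^n x. *)
have := @sum_exp_card_neq0 R 'I_n x x0; rewrite card_ord => /(_ nx); apply: le_trans.
rewrite [leRHS]big_mkcond; apply: ler_sum => S _; rewrite /bad /=.
case: (boolP (cond c d S)) => [|_] /=; last first.
  by rewrite Ex_cst//; case: ifP => // _; rewrite exprn_ge0.
move=> /and4P[_ S0 SV S2]; rewrite S0.
apply: le_trans (Ex_avoid mu_ge0 mu1 (D := cut S (block kap c d :\: S)%SET)
  (g := fun a : bool * F => a.1) (x := p) _) _; first by move=> e _; apply: hp.
rewrite /x -expRM_natl ler_expR mulrN lerN2.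
have hcut := @leq_card_cut n S (block kap c d :\: S)%SET.
have {}hcut : (#|S| * #|(block kap c d :\: S)%SET| <= #|cut S (block kap c d :\: S)%SET|)%N.
  by apply: hcut; rewrite finset.disjoints_subset; apply/fintype.subsetP => u uS; rewrite !inE uS.
have cV : (#|block kap c d| <= 2 * #|(block kap c d :\: S)%SET|)%N.
  have := cardsID S (block kap c d); rewrite (finset.setIidPr SV); lia.
have mV : m <= #|block kap c d|%:R.
  apply: le_trans (hm c) _; rewrite ler_nat; apply: subset_leq_card.
  by apply/fintype.subsetP => u; rewrite !inE => ->.
have {cV} : #|block kap c d|%:R <= 2 * #|(block kap c d :\: S)%SET|%:R :> R.
  by rewrite -natrM ler_nat.
have : #|S|%:R * #|(block kap c d :\: S)%SET|%:R <= #|cut S (block kap c d :\: S)%SET|%:R :> R.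
  by rewrite -natrM ler_nat.
move: (#|cut _ _|%:R : R) (#|(_ :\: _)%SET|%:R : R) (#|S|%:R : R) (ler0n R #|S|) => y v z z0 h1 h2.
have h3 : z * (m / 2) <= y.
  by apply: le_trans h1; rewrite ler_wpM2l//; lra.
by have := ler_wpM2l p0 h3; lra.
Qed.

(** Union bound over at most 2^n <= e^n sets U, each avoiding the many pairs supplied by
    [card_same_cell]. The bound is uniform in [kap]. *)
Lemma Ex_sparse kap (g : pred (bool * F)) (q : R) : 0 <= q ->
  (forall e, q <= \sum_(a | g a) mu e a) ->
  Ex mu (fun bet => [exists U : {set 'I_n}, (n <= 2 * #|U|)%N &&
     [forall e in same_cell kap U, ~~ g (bet e)]]%:R) <=
  expR (n%:R - q * (n%:R ^+ 2 / (8 * #|{: cell k}|%:R) - n%:R / 2)).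
Proof.
move=> q0 hq; set m := _ - n%:R / 2.
apply: le_trans (Ex_exists mu_ge0 _) _.
apply: (@le_trans _ _ (\sum_(U : {set 'I_n}) expR (- (q * m)))); last first.
  rewrite sumr_const -[leLHS]mulr_natl expRD ler_wpM2r ?expR_ge0//.
  rewrite -cardsT -powersetT card_powerset cardsT card_ord natrX.
  rewrite -[n%:R]mulr1 expRM_natl lerXn2r ?nnegrE ?expR_ge0//.
  by have := expR_ge1Dx (1 : R); lra.
apply: ler_sum => U _.
case: (boolP (n <= 2 * #|U|)%N) => [nU|_] /=; last by rewrite Ex_cst ?expR_ge0.
apply: le_trans (Ex_avoid mu_ge0 mu1 (x := q) _) _; first by move=> e _; apply: hq.
by rewrite ler_expR lerN2 ler_wpM2l// /m card_same_cell.
Qed.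

End FiniteModel.

(** * Discretization of the probability space *)

Section FiniteValued.
Context d (T : measurableType d).

(** Measurability for the discrete sigma-algebra on [A], stated on fibres. *)
Definition fin_measurable (A : finType) (g : T -> A) :=
  forall a, measurable (g @^-1` [set a]).

Lemma fin_measurable_set (A : finType) (g : T -> A) (Q : pred A) :
  fin_measurable g -> measurable [set w | Q (g w)].
Proof.
move=> mg; rewrite (_ : [set w | Q (g w)] = \bigcup_(a in [set` Q]) (g @^-1` [set a])).
  exact: fin_bigcup_measurable.
by apply/seteqP; split => [w Qw|w [a /= Qa ->]//]; exists (g w).
Qed.

Lemma fin_measurable_measure (R : realType) (P : {measure set T -> \bar R})
    (A : finType) (g : T -> A) (Q : pred A) : fin_measurable g ->
  P [set w | Q (g w)] = (\sum_(a | Q a) P (g @^-1` [set a]))%E.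
Proof.
move=> mg; rewrite (_ : [set w | Q (g w)] = \bigcup_(a in [set` Q]) (g @^-1` [set a])).
  rewrite measure_fin_bigcup//.
    rewrite [RHS]bigfs ?index_enum_uniq//; by move=> a _; rewrite mem_index_enum.
  by move=> a b _ _ [w] /= []; congruence.
by apply/seteqP; split => [w Qw|w [a /= Qa ->]//]; exists (g w).
Qed.

Lemma fin_measurable_comp (A A' : finType) (f : A -> A') (g : T -> A) :
  fin_measurable g -> fin_measurable (f \o g).
Proof.
move=> mg a.
rewrite (_ : _ @^-1` _ = [set w | (fun x => f x == a) (g w)]).
  exact: (@fin_measurable_set A g (fun x => f x == a)).
by apply/seteqP; split => w /= /eqP.
Qed.

Lemma fin_measurable_ffun (I A : finType) (g : I -> T -> A) :
  (forall i, fin_measurable (g i)) -> fin_measurable (fun w => [ffun i => g i w]).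
Proof.
move=> mg b.
rewrite (_ : _ @^-1` _ = \bigcap_i (g i @^-1` [set b i])).
  by apply: fin_bigcap_measurable => // i _; apply: mg.
apply/seteqP; split => [w /= <- i _ /=|w /= wb]; first by rewrite ffunE.
by apply/ffunP => i; rewrite ffunE; apply: wb.
Qed.

Lemma fin_measurable_pair (A A' : finType) (g : T -> A) (g' : T -> A') :
  fin_measurable g -> fin_measurable g' -> fin_measurable (fun w => (g w, g' w)).
Proof.
move=> mg mg' [a a'].
rewrite (_ : _ @^-1` _ = (g @^-1` [set a]) `&` (g' @^-1` [set a'])).
  exact: measurableI.
by apply/seteqP; split => w /= [-> ->].
Qed.

Lemma fin_measurable_bool (b : T -> bool) :
  measurable [set w | b w] -> fin_measurable b.
Proof.
move=> mb [].
  by rewrite (_ : _ @^-1` _ = [set w | b w]).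
rewrite (_ : _ @^-1` _ = ~` [set w | b w]); first exact: measurableC.
by apply/seteqP; split => w /=; case: (b w).
Qed.

End FiniteValued.

Section Levels.
Variables (R : realType) (t : nat -> R) (J : nat).

(** For monotone thresholds the exceeded ones form an initial segment, so their number locates x.
    The same map discretizes weights and, with grid lines as thresholds, coordinates. *)
Definition level (x : R) : 'I_J.+1 := inord (\sum_(j < J) (t j < x)%R).

Lemma level_val x : level x = (\sum_(j < J) (t j < x)%R)%N :> nat.
Proof.
rewrite inordK// ltnS -[leqRHS]card_ord -sum1_card.
by apply: leq_sum => j _; case: (_ < _).
Qed.

Lemma ltn_level x j : {homo t : i j / (i <= j)%N >-> i <= j} -> (j < J)%N ->
  (j < level x)%N = (t j < x).
Proof.
move=> th jJ; rewrite level_val.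
have sum_lt m k : (\sum_(i < k) (i < m) = minn k m)%N.
  elim: k => [|k IH]; first by rewrite big_ord0 min0n.
  by rewrite big_ord_recr/= IH; lia.
case: (ltP (t j) x) => [jx|xj].
- have := sum_lt j.+1 J; rewrite (minn_idPr jJ) => {1}<-.
  apply: leq_sum => i _; rewrite ltnS; case: (leqP i j) => // ij.
  by rewrite (le_lt_trans (th _ _ ij) jx).
- apply/negbTE; rewrite -leqNgt.
  have := sum_lt j J; rewrite (minn_idPr (ltnW jJ)) => {1}<-.
  apply: leq_sum => i _; case: (ltnP i j) => [_|ji]; first by case: (_ < _).
  by rewrite ltNge (le_trans xj (th _ _ ji)).
Qed.

Lemma fin_measurable_level d (T : measurableType d) (Y : T -> R) :
  measurable_fun setT Y -> fin_measurable (fun w => level (Y w)).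
Proof.
move=> mY.
pose f (b : {ffun 'I_J -> bool}) : 'I_J.+1 := inord (\sum_(j < J) b j).
rewrite (_ : (fun w => _) = f \o (fun w => [ffun j : 'I_J => t j < Y w])).
  apply/fin_measurable_comp/fin_measurable_ffun => j; apply: fin_measurable_bool.
  rewrite (_ : [set w | _] = setT `&` Y @^-1` `]t j, +oo[%classic).
    by apply: mY => //; apply: measurable_itv.
  by rewrite setTI; apply/seteqP; split => w /=; rewrite in_itv/= andbT.
apply/funext => w; rewrite /level /f /=; congr inord.
by apply: eq_bigr => j _; rewrite ffunE.
Qed.

End Levels.

Lemma sigma_of_bigcap d (T : measurableType d) d' (T' : measurableType d')
    (I : finType) (Y : I -> T -> T') (A : I -> set T') :
  (forall i, measurable (A i)) -> sigma_of Y (\bigcap_i (Y i @^-1` A i)).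
Proof.
move=> mA; rewrite /sigma_of; set G := \bigcup_i _.
apply: (@fin_bigcap_measurable _ (g_sigma_algebraType G)) => // i _.
apply: sub_sigma_algebra; exists i => //; exists (A i) => //.
by rewrite setTI.
Qed.

(** * Transfer of probabilities to finite sums *)

Section Transfer.
Context {R : realType} {f : plane R -> R} {Fc : R -> R} {n : nat} {p : R}.
Variables (B : brgg_space f Fc n p) (F C : finType) (phi : R -> F) (c : plane R -> C).
Hypothesis mphi : fin_measurable phi.
Hypothesis mc : fin_measurable c.
Local Notation P := (prob B).

Definition edge_obs (w : sample B) : {ffun edge n -> bool * F} :=
  [ffun e => (edge_state B e w, phi (edge_weight B e w))].
Definition loc_obs (w : sample B) : {ffun 'I_n -> C} := [ffun i => c (location B i w)].

Definition edge_law (e : edge n) (a : bool * F) : R :=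
  (if a.1 then p else 1 - p) * fine (P (edge_weight B e @^-1` (phi @^-1` [set a.2]))).
Definition loc_law (i : 'I_n) (a : C) : R :=
  fine (P (location B i @^-1` (c @^-1` [set a]))).

Lemma prob_edge_state e z :
  P (edge_state B e @^-1` [set z]) = (if z then p else 1 - p)%:E.
Proof.
case: z; first exact: Z_law.
rewrite (_ : _ @^-1` _ = ~` (edge_state B e @^-1` [set true])).
  by rewrite probability_setC ?Z_law//; apply: measurable_funPTI.
by apply/seteqP; split => w /=; case: (edge_state B e w).
Qed.

Lemma fin_measurable_edge_state e : fin_measurable (edge_state B e).
Proof. by move=> z; apply: measurable_funPTI. Qed.

Lemma fin_measurable_edge_weight e : fin_measurable (fun w => phi (edge_weight B e w)).
Proof. by move=> z; exact: (measurable_funPTI (edge_weight B e) (mphi z)). Qed.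

Lemma fin_measurable_location i : fin_measurable (fun w => c (location B i w)).
Proof. by move=> z; exact: (measurable_funPTI (location B i) (mc z)). Qed.

Lemma fin_measurable_obs : fin_measurable (fun w => (loc_obs w, edge_obs w)).
Proof.
apply: fin_measurable_pair; apply: fin_measurable_ffun.
  exact: fin_measurable_location.
move=> e; apply: fin_measurable_pair; first exact: fin_measurable_edge_state.
exact: fin_measurable_edge_weight.
Qed.

(** All four independence assumptions are consumed here: the fibre is an intersection of three
    cylinder events, one for each family. *)
Lemma obs_law k b : P ((fun w => (loc_obs w, edge_obs w)) @^-1` [set (k, b)]) =
  ((\prod_i loc_law i (k i)) * \prod_e edge_law e (b e))%:E.
Proof.
pose AZ := \bigcap_e (edge_state B e @^-1` [set (b e).1]).
pose AW := \bigcap_e (edge_weight B e @^-1` (phi @^-1` [set (b e).2])).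
pose AX := \bigcap_i (location B i @^-1` (c @^-1` [set k i])).
rewrite (_ : _ @^-1` _ = AZ `&` AW `&` AX); last first.
  apply/seteqP; split => w /=.
    move=> [wk wb]; split; [split|] => i _ /=.
    - by rewrite -wb ffunE.
    - by rewrite -wb ffunE.
    - by rewrite -wk ffunE.
  move=> [[wZ wW] wX]; congr (_, _); apply/ffunP => i; rewrite ffunE; first exact: wX.
  by rewrite wZ// wW//; case: (b i).
rewrite ZWX_indep; last 3 first.
- exact: sigma_of_bigcap.
- by apply: (sigma_of_bigcap (A := fun e => phi @^-1` [set (b e).2])) => e; apply: mphi.
- by apply: (sigma_of_bigcap (A := fun i => c @^-1` [set k i])) => i; apply: mc.
- have /= -> // := @Z_indep _ _ _ _ _ B (fun e => [set (b e).1]).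
  have /= -> := @W_indep _ _ _ _ _ B (fun e => phi @^-1` [set (b e).2]) (fun e => mphi _).
  have /= -> := @X_indep _ _ _ _ _ B (fun i => c @^-1` [set k i]) (fun i => mc _).
  rewrite (eq_bigr _ (fun e _ => prob_edge_state e (b e).1)).
  have fK (A : set (sample B)) : measurable A -> P A = (fine (P A))%:E.
    by move=> mA; rewrite fineK// fin_num_measure.
  rewrite [X in (_ * X * _)%E](eq_bigr _ (fun e _ => fK _ (fin_measurable_edge_weight e (b e).2))).
  rewrite [X in (_ * _ * X)%E](eq_bigr _ (fun i _ => fK _ (fin_measurable_location i (k i)))).
  by rewrite !prodEFin -!EFinM -big_split/= mulrC.
Qed.

(** The nested form is Fubini's theorem for the finite model; the inner expectation can be bounded
    for each fixed cell map. *)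
Lemma prob_obs (Q : {ffun 'I_n -> C} -> {ffun edge n -> bool * F} -> bool) :
  P [set w | Q (loc_obs w) (edge_obs w)] =
  (Ex loc_law (fun k => Ex edge_law (fun b => (Q k b)%:R)))%:E.
Proof.
rewrite (@fin_measurable_measure _ _ _ P _ (fun w => (loc_obs w, edge_obs w))
  (fun kb => Q kb.1 kb.2) fin_measurable_obs).
rewrite (eq_bigr (fun kb : {ffun 'I_n -> C} * {ffun edge n -> bool * F} =>
  ((\prod_i loc_law i (kb.1 i)) * \prod_e edge_law e (kb.2 e))%:E)); last first.
  by move=> [k b] _; apply: obs_law.
rewrite sumEFin; congr EFin; rewrite big_mkcond /Ex.
rewrite -(pair_big xpredT xpredT
  (fun (k : {ffun 'I_n -> C}) (b : {ffun edge n -> bool * F}) => if Q k b then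
   (\prod_i loc_law i (k i)) * \prod_e edge_law e (b e) else 0))/=.
apply: eq_bigr => k _; rewrite mulr_sumr; apply: eq_bigr => b _.
by case: (Q k b); rewrite ?mulr1 ?mulr0.
Qed.

Lemma edge_law_ge0 e a : 0 < p < 1 -> 0 <= edge_law e a.
Proof.
by move=> ?; rewrite mulr_ge0 ?fine_ge0//; case: a.1; lra.
Qed.

Lemma loc_law_ge0 i a : 0 <= loc_law i a.
Proof. by rewrite fine_ge0. Qed.

Lemma sum_edge_law e z (S : pred F) :
  \sum_(a | (a.1 == z) && S a.2) edge_law e a =
  (if z then p else 1 - p) * fine (P [set w | S (phi (edge_weight B e w))]).
Proof.
rewrite (@fin_measurable_measure _ _ _ P _ _ S (fin_measurable_edge_weight e)).
rewrite (eq_bigr (fun a => (fine (P (edge_weight B e @^-1` (phi @^-1` [set a]))))%:E)); last first.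
  by move=> a _; rewrite fineK// fin_num_measure//; apply: fin_measurable_edge_weight.
rewrite sumEFin/= mulr_sumr.
rewrite -(pair_big (pred1 z) S (fun z a => edge_law e (z, a)))/= big_pred1_eq.
by [].
Qed.

Lemma edge_law1 e : \sum_a edge_law e a = 1.
Proof.
rewrite (bigID (fun a => a.1 == true))/=.
rewrite (eq_bigl (fun a => (a.1 == true) && predT a.2)); last by move=> a; rewrite andbT.
rewrite sum_edge_law.
rewrite (eq_bigl (fun a => (a.1 == false) && predT a.2)); last first.
  by move=> [[] a].
rewrite sum_edge_law /=.
have -> : [set w : sample B | true] = setT by apply/seteqP.
by rewrite probability_setT/=; lra.
Qed.

Lemma loc_law1 i : \sum_a loc_law i a = 1.
Proof.
apply: EFin_inj; rewrite -sumEFin.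
rewrite (eq_bigr (fun a => P ((fun w => c (location B i w)) @^-1` [set a]))); last first.
  by move=> a _; rewrite fineK// fin_num_measure//; apply: fin_measurable_location.
rewrite -(@fin_measurable_measure _ _ _ P _ _ xpredT (fin_measurable_location i)).
have -> : [set w : sample B | xpredT (c (location B i w))] = setT by apply/seteqP.
exact: probability_setT.
Qed.

End Transfer.

(** * Geometry of the cells *)

Section GridCells.
Variables (R : realType) (k : nat).
Local Notation K := (k.+1%:R : R).

Definition grid_line (j : nat) : R := j.+1%:R / K.

(** Only the k inner grid lines are thresholds, so level i is the interval ]i/K, (i+1)/K], except
    that the first and last levels extend to infinity: the point 0 is in the first cell, and points
    outside the square are assigned too. *)
Definition cell_of (x : plane R) : cell k :=
  (level grid_line k (x.1 : R), level grid_line k (x.2 : R)).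

Lemma grid_line_homo : {homo grid_line : i j / (i <= j)%N >-> i <= j}.
Proof. by move=> i j ij; rewrite ler_wpM2r ?invr_ge0 ?ler0n// ler_nat. Qed.

Lemma level_bounds (x : R) : 0 <= x <= 1 ->
  (level grid_line k x)%:R / K <= x <= (level grid_line k x).+1%:R / K.
Proof.
move=> /andP[x0 x1]; have := @ltn_level R grid_line k x ^~ grid_line_homo.
move: (level _ _ _) => [i /= ik] h; apply/andP; split.
  case: i ik h => [|i] ik h; first by rewrite mul0r.
  by have := h i ik; rewrite ltnSn => /esym/ltW.
move: ik; rewrite ltnS leq_eqVlt => /orP[/eqP ->|ik]; first by rewrite divff// pnatr_eq0.
by have := h i ik; rewrite ltnn => /esym/negbT; rewrite -leNgt.
Qed.

Lemma level_eq (x : R) (i : 'I_k.+1) : i%:R / K < x <= i.+1%:R / K ->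
  level grid_line k x = i.
Proof.
move=> /andP[ix xi]; have lvl := @ltn_level R grid_line k x ^~ grid_line_homo.
apply: val_inj; apply/eqP; rewrite eqn_leq; apply/andP; split; rewrite leqNgt; apply/negP => h.
  have ik : (i < k)%N by apply: leq_trans h _; rewrite -ltnS; apply: ltn_ord.
  by rewrite lvl// in h; rewrite ltNge xi in h.
case: i ix xi h => [[|i] /= ik] ix xi // h.
have : (i < level grid_line k x)%N by rewrite lvl.
by move=> /(leq_trans h); rewrite ltnn.
Qed.

Lemma fin_measurable_cell_of : fin_measurable cell_of.
Proof.
apply: fin_measurable_pair; apply: fin_measurable_level.
  exact: measurable_fst.
exact: measurable_snd.
Qed.

Lemma close_level (x y : R) l : 0 <= x <= 1 -> 0 <= y <= 1 ->
  (level grid_line k x <= level grid_line k y + l)%N -> K * (x - y) <= l.+1%:R.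
Proof.
move=> /level_bounds/andP[_ xu] /level_bounds/andP[yl _] h.
have K0 : 0 < K by rewrite ltr0n.
move: xu yl; rewrite ler_pdivlMr// ler_pdivrMr// -[(level _ _ x).+1%:R]natr1 => xu yl.
have : (level grid_line k x)%:R <= (level grid_line k y)%:R + l%:R :> R by rewrite -natrD ler_nat.
rewrite -[l.+1%:R]natr1; lra.
Qed.

Lemma level_close (x y : R) l : 0 <= x <= 1 -> 0 <= y <= 1 ->
  K * (x - y) < l%:R -> (level grid_line k x <= level grid_line k y + l.+1)%N.
Proof.
move=> /level_bounds/andP[xl _] /level_bounds/andP[_ yu] h.
have K0 : 0 < K by rewrite ltr0n.
move: xl yu; rewrite ler_pdivlMr// ler_pdivrMr// => xl yu.
rewrite -ltnS -(ltr_nat R) -addnS natrD.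
have : l.+2%:R = l%:R + 2 :> R by rewrite -addn2 natrD.
move: yu; rewrite -[(level _ _ y).+1%:R]natr1; lra.
Qed.

Lemma close_dist (x y : plane R) r : unit_square R x -> unit_square R y ->
  0 < r -> 3 < K * r -> close 1 (cell_of x) (cell_of y) -> euclid_dist x y < r.
Proof.
move=> [x1 x2] [y1 y2] r0 Kr /and4P[h1 h2 h3 h4].
have K0 : 0 < K by rewrite ltr0n.
have := close_level x1 y1 h1; have := close_level y1 x1 h2.
have := close_level x2 y2 h3; have := close_level y2 x2 h4.
rewrite /euclid_dist; move: (x.1 - y.1 : R) (y.1 - x.1 : R) (opprB (x.1 : R) y.1) => a _ <-.
move: (x.2 - y.2 : R) (y.2 - x.2 : R) (opprB (x.2 : R) y.2) => b _ <-.
move=> b1 b2 a1 a2.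
rewrite -[ltRHS](gtr0_norm r0) -sqrtr_sqr ltr_sqrt ?exprn_gt0//.
rewrite -(ltr_pM2l (exprn_gt0 2 K0)) mulrDr -!exprMn.
(* Coordinates in neighbouring cells differ by at most 2/K, and 4 + 4 < 9 < (K r)^2. *)
have ha : (K * a) ^+ 2 <= 4 by rewrite mulrN in a1; nra.
have hb : (K * b) ^+ 2 <= 4 by rewrite mulrN in b1; nra.
nra.
Qed.

(** Coordinates differ by less than r <= 4/K; [level_close] with l = 4 adds one cell. *)
Lemma dist_close (x y : plane R) r : unit_square R x -> unit_square R y ->
  0 < r -> K * r <= 4 -> euclid_dist x y < r -> close 5 (cell_of x) (cell_of y).
Proof.
move=> [x1 x2] [y1 y2] r0 Kr.
have K0 : 0 < K by rewrite ltr0n.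
rewrite /euclid_dist -[X in _ < X -> _](gtr0_norm r0) -sqrtr_sqr ltr_sqrt ?exprn_gt0// => h.
have key (a b : R) : a ^+ 2 + b ^+ 2 < r ^+ 2 -> K * a < 4.
  move=> ab; apply: lt_le_trans Kr; rewrite ltr_pM2l//.
  have : a ^+ 2 < r ^+ 2 by have := sqr_ge0 b; lra.
  rewrite ltNge; apply: contraNlt => ra; rewrite ler_pXn2r ?nnegrE ?(ltW r0)//.
  by apply: le_trans ra; apply: ltW.
apply/and4P; split; apply: level_close => //.
- exact: key h.
- by apply: (key _ (x.2 - y.2 : R)); rewrite -opprB sqrrN.
- by apply: (key _ (x.1 - y.1 : R)); rewrite addrC.
- by apply: (key _ (x.1 - y.1 : R)); rewrite addrC -[y.2 - x.2]opprB sqrrN.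
Qed.

End GridCells.

(** * Cell probabilities under the density *)

Section Density.
Context {R : realType} (f : plane R -> R) (eps1 eps2 : R).
Hypothesis eps1_gt0 : 0 < eps1.
Hypothesis f_density : square_density f.
Hypothesis f_bounds : forall x, unit_square R x -> eps1 <= f x <= eps2.
Context d (T : measurableType d) (P : probability T R) (X : {RV P >-> plane R}).
Hypothesis Xf : has_square_density X f.

Lemma unit_squareE : unit_square R = (`[0, 1]%classic `*` `[0, 1]%classic).
Proof. by apply/seteqP; split => x; rewrite /unit_square /= !in_itv. Qed.

Lemma measurable_unit_square : measurable (unit_square R).
Proof. by rewrite unit_squareE; apply: measurableX; apply: measurable_itv. Qed.

Lemma prob_outside_square : P (X @^-1` (~` unit_square R)) = 0.
Proof.
have := Xf (measurableC measurable_unit_square).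
by rewrite setICl integral_set0.
Qed.

Lemma le_prob_location (A A' : set (plane R)) : measurable A -> measurable A' ->
  A `&` unit_square R `<=` A' -> (P (X @^-1` A) <= eps2%:E * lebesgue2 R A')%E.
Proof.
move=> mA mA' AA'; have := Xf mA; rewrite /distribution/= /pushforward => ->.
have mAS : measurable (A `&` unit_square R) := measurableI _ _ mA measurable_unit_square.
have [mf f0 _] := f_density.
apply: (@le_trans _ _ (\int[lebesgue2 R]_(x in A `&` unit_square R) (cst eps2%:E x))%E).
  apply: ge0_le_integral => //.
  - by move=> x [_ Sx]; rewrite lee_fin f0.
  - apply/measurable_EFinP; apply: measurable_funS mf; first exact: measurable_unit_square.
    exact: subIsetr.
  - by move=> x [_ Sx]; rewrite lee_fin; case/andP: (f_bounds Sx).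
rewrite integral_cst// lee_wpmul2l//.
  have [x Sx] : exists x, unit_square R x.
    by exists (0, 0); split; rewrite /= lexx ler01.
  by rewrite lee_fin; have /andP[h1 h2] := f_bounds Sx; apply: ltW (lt_le_trans eps1_gt0 (le_trans h1 h2)).
by rewrite le_measure ?inE.
Qed.

Lemma ge_prob_location (A A' : set (plane R)) : measurable A -> measurable A' ->
  A' `<=` A `&` unit_square R -> (eps1%:E * lebesgue2 R A' <= P (X @^-1` A))%E.
Proof.
move=> mA mA' AA'; have := Xf mA; rewrite /distribution/= /pushforward => ->.
have mAS : measurable (A `&` unit_square R) := measurableI _ _ mA measurable_unit_square.
have [mf f0 _] := f_density.
apply: (@le_trans _ _ (\int[lebesgue2 R]_(x in A `&` unit_square R) (cst eps1%:E x))%E).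
  by rewrite integral_cst// lee_wpmul2l ?lee_fin ?(ltW eps1_gt0)// le_measure ?inE.
apply: ge0_le_integral => //.
- by move=> x _; rewrite lee_fin ltW.
- apply/measurable_EFinP; apply: measurable_funS mf; first exact: measurable_unit_square.
  exact: subIsetr.
- by move=> x [_ Sx]; rewrite lee_fin; case/andP: (f_bounds Sx).
Qed.

Lemma lebesgue2_box (a b c d' : R) x1 x2 y1 y2 : a <= b -> c <= d' ->
  lebesgue2 R ([set` Interval (BSide x1 a) (BSide x2 b)] `*`
               [set` Interval (BSide y1 c) (BSide y2 d')]) = ((b - a) * (d' - c))%:E.
Proof.
move=> ab cd.
have mitv (i : interval R) : measurable ([set` i] : set (measurableTypeR R)) := measurable_itv i.
have /= h := @product_measure1E _ _ (measurableTypeR R) (measurableTypeR R) R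
  (@lebesgue_measure R) (@lebesgue_measure R) _ _
  (mitv (Interval (BSide x1 a) (BSide x2 b))) (mitv (Interval (BSide y1 c) (BSide y2 d'))).
rewrite [LHS]h !lebesgue_measure_itv/= !lte_fin -!EFinD EFinM.
congr (_ * _)%E.
  by case: ltgtP ab => // ->; rewrite subrr.
by case: ltgtP cd => // ->; rewrite subrr.
Qed.

(** The cell contains a half-open box, and its part in the square lies in the closed box of the same
    area K^(-2). *)
Lemma prob_cell k (c : cell k) :
  ((eps1 / k.+1%:R ^+ 2)%:E <= P (X @^-1` (@cell_of R k @^-1` [set c])) <= (eps2 / k.+1%:R ^+ 2)%:E)%E.
Proof.
set K := (k.+1%:R : R); have K0 : 0 < K by rewrite ltr0n.
have mc := @fin_measurable_cell_of R k c.
have width (i : nat) : i.+1%:R / K - i%:R / K = K^-1 by rewrite -mulrBl -natrB// subSnn mul1r.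
have le_width (i : nat) : i%:R / K <= i.+1%:R / K by rewrite ler_pM2r ?invr_gt0// ler_nat.
have KE e : e / K ^+ 2 = e * (K^-1 * K^-1) by rewrite expr2 invfM.
have bnd (i : 'I_k.+1) (x : R) : i%:R / K < x <= i.+1%:R / K -> 0 <= x <= 1.
  move=> /andP[h1 h2]; apply/andP; split.
    by apply: ltW; apply: le_lt_trans h1; rewrite divr_ge0// ltW.
  by apply: le_trans h2 _; rewrite ler_pdivrMr// mul1r ler_nat.
apply/andP; split.
  pose A' : set (plane R) := `](c.1%:R / K), (c.1.+1%:R / K)]%classic `*`
                             `](c.2%:R / K), (c.2.+1%:R / K)]%classic.
  have := @ge_prob_location _ A' mc; rewrite lebesgue2_box// !width -EFinM -KE; apply.
    by apply: measurableX; apply: measurable_itv.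
  move=> [x1 x2] []; rewrite /= !in_itv/= => h1 h2; split; last by split; apply: bnd; eassumption.
  by rewrite /= /cell_of /= (level_eq h1) (level_eq h2) -surjective_pairing.
pose A' : set (plane R) := `[(c.1%:R / K), (c.1.+1%:R / K)]%classic `*`
                           `[(c.2%:R / K), (c.2.+1%:R / K)]%classic.
have := @le_prob_location _ A' mc; rewrite lebesgue2_box// !width -EFinM -KE; apply.
  by apply: measurableX; apply: measurable_itv.
move=> [x1 x2] [/= ec [/= /(@level_bounds R k) h1 /(@level_bounds R k) h2]].
by rewrite /A' -ec; split; rewrite /= in_itv.
Qed.

End Density.

(** * Tail of the weights *)

Section Tail.
Context {R : realType} (Fc : R -> R).
Hypothesis Fc_ccdf : is_positive_ccdf Fc.

Lemma ccdf_ge0 x : 0 < x -> 0 <= Fc x.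
Proof.
have [d [T [P [Y [_ YF]]]]] := Fc_ccdf.
by move=> x0; rewrite -lee_fin -YF// /ccdf.
Qed.

Lemma ccdf_le x y : 0 < x -> x <= y -> Fc y <= Fc x.
Proof.
have [d [T [P [Y [_ YF]]]]] := Fc_ccdf.
move=> x0 xy; rewrite -lee_fin -YF ?(lt_le_trans x0)// -YF//.
exact: ccdf_nonincreasing.
Qed.

Lemma ccdf_vanish e : 0 < e -> exists2 x, 0 < x & Fc x < e.
Proof.
have [d [T [P [Y [_ YF]]]]] := Fc_ccdf; move=> e0.
have : \forall x \near +oo%R, (ccdf Y x < e%:E)%E.
  exact: (@cvg_ccdfy0 _ _ _ P Y _ (@nbhs_open_ereal_lt R 0 (cst e) e0)).
move=> h; have [x [x0 xe]] : exists x, 0 < x /\ (ccdf Y x < e%:E)%E.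
  by near (+oo%R : set_system R) => x; exists x; split; near: x => //; exact: nbhs_pinfty_gt.
by exists x => //; rewrite -lte_fin -YF.
Unshelve. all: by end_near. Qed.

(** A positive weight has ccdf 1 at 0, and right continuity keeps it above 1/2 nearby. Hence
    [H Fc z] is at least this x for every z >= 2. *)
Lemma ccdf_half : exists2 x, 0 < x & 2^-1 <= Fc x.
Proof.
have [d [T [P [Y [Y0 YF]]]]] := Fc_ccdf.
have c0 : ccdf Y 0 = 1%E.
  rewrite /ccdf /distribution /pushforward /= (_ : _ @^-1` _ = setT) ?probability_setT//.
  by apply/seteqP; split => w //= _; rewrite in_itv/= andbT.
have : \forall x \near (0 : R)^'+, (2^-1%:E < ccdf Y x)%E.
  have h := @ccdf_right_continuous _ _ _ P Y 0; rewrite c0 in h.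
  apply: (h _ (@nbhs_open_ereal_gt R 1 (cst 2^-1) _)).
  by rewrite /= invf_lt1// ltr1n.
move=> h; have [x [x0 xe]] : exists x, 0 < x /\ (2^-1%:E < ccdf Y x)%E.
  by near (0 : R)^'+ => x; exists x; split; near: x => //; exact: nbhs_right_gt.
by exists x => //; rewrite -lee_fin -YF// ltW.
Unshelve. all: by end_near. Qed.

Lemma has_ubound_H z : 0 < z -> has_ubound [set x : R | 0 < x /\ z^-1 <= Fc x].
Proof.
move=> z0; have [y y0 yz] : exists2 y, 0 < y & Fc y < z^-1 by apply: ccdf_vanish; rewrite invr_gt0.
exists y => x [x0 zx]; rewrite leNgt; apply/negP => yx.
by have := le_lt_trans (le_trans zx (ccdf_le y0 (ltW yx))) yz; rewrite ltxx.
Qed.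

Lemma ccdf_gt_H z x : 0 < z -> 0 < x -> H Fc z < x -> Fc x < z^-1.
Proof.
move=> z0 x0; rewrite !ltNge; apply: contra => zx.
by apply: ub_le_sup => //; exact: has_ubound_H.
Qed.

Lemma le_H z x : 0 < z -> 0 < x -> z^-1 <= Fc x -> x <= H Fc z.
Proof. by move=> z0 x0 zx; apply: ub_le_sup => //; exact: has_ubound_H. Qed.

(** The supremum need not be attained, hence the half. Positivity rules out the empty set, whose
    [sup] is 0 by convention. *)
Lemma ccdf_H_half z : 0 < z -> 0 < H Fc z -> z^-1 <= Fc (H Fc z / 2).
Proof.
move=> z0 H0; have h2 : H Fc z / 2 < H Fc z by lra.
have [|x [x0 zx] hx] := @sup_gt _ [set x : R | 0 < x /\ z^-1 <= Fc x] _ _ h2.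
  apply/set0P/eqP => e; move: H0; rewrite /H e sup0 ltxx; done.
by apply: le_trans zx (ccdf_le _ (ltW hx)); rewrite divr_gt0.
Qed.

(** Here rho = 4/2^s, which is below 1 exactly because s > 2: the tail then beats the growth 4^j of
    squared dyadic weights. [C + 1] covers j = 0, where the hypothesis with a > 1 does not apply. *)
Lemma ccdf_geometric C x0 s : 0 < C -> 0 < x0 -> 2 < s ->
  (forall a x : R, 1 < a -> x0 < x -> Fc (a * x) <= C / (a `^ s) * Fc x) ->
  exists2 rho, 0 < rho < 1 & forall b j, x0 < b ->
    Fc (2 ^+ j * b) <= (C + 1) * (rho / 4) ^+ j * Fc b.
Proof.
move=> C0 x00 s2 hF; exists (4 / (2 `^ s)).
  rewrite divr_gt0 ?powR_gt0//= ltr_pdivrMr ?powR_gt0// mul1r.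
  have -> : 4 = 2 `^ 2 :> R by rewrite powR_mulrn// expr2; lra.
  have s20 : 0 < s - 2 by lra.
  have : 2 `^ (s - 2 + 2) = 2 `^ (s - 2) * 2 `^ 2 :> R.
    by apply: powRD; apply/implyP => _; rewrite pnatr_eq0.
  rewrite subrK => ->.
  rewrite -[ltLHS]mul1r ltr_pM2r ?powR_gt0//.
  rewrite [ltLHS](_ : 1 = 1 `^ (s - 2)); last by rewrite powR1.
  by apply: gt0_ltr_powR => //; rewrite ?nnegrE ?ler0n ?ler01 ?ltr1n.
move=> b j xb; have b0 : 0 < b by apply: lt_trans xb.
have Fb := ccdf_ge0 b0.
have -> : 4 / 2 `^ s / 4 = (2 `^ s)^-1 :> R by field; rewrite gt_eqF// powR_gt0.
case: j => [|j]; first by rewrite !expr0 mul1r mulr1; nra.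
apply: le_trans (hF _ _ _ xb) _; first by rewrite exprn_egt1// ltr1n.
rewrite ler_wpM2r// exprVn.
have -> : (2 ^+ j.+1) `^ s = (2 `^ s) ^+ j.+1 :> R.
  by rewrite -(powR_mulrn _ (ler0n _ 2)) -(powR_mulrn _ (powR_ge0 2 s)) -[LHS]powRrM -[RHS]powRrM mulrC.
by rewrite ler_wpM2r ?invr_ge0 ?exprn_ge0 ?powR_ge0// lerDl.
Qed.

End Tail.

(** * The random graph and its discrete model *)

Lemma measurable_bigmax (R : realType) d (T : measurableType d) (I : Type) (s : seq I)
    (P : I -> T -> bool) (F : I -> T -> R) :
  (forall i, measurable [set w | P i w]) -> (forall i, measurable_fun setT (F i)) ->
  measurable_fun setT (fun w => \big[Num.max/0]_(i <- s | P i w) F i w).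
Proof.
move=> mP mF; elim: s => [|i s IH].
  by rewrite (_ : (fun _ => _) = cst 0)//; apply/funext => w; rewrite big_nil.
rewrite (_ : (fun _ => _) = (fun w => if P i w
  then Num.max (F i w) (\big[Num.max/0]_(j <- s | P j w) F j w)
  else \big[Num.max/0]_(j <- s | P j w) F j w)).
  apply: measurable_fun_ifT => //; last exact: measurable_maxr.
  by apply: (measurable_fun_bool true); rewrite setTI; apply: mP.
by apply/funext => w; rewrite big_cons.
Qed.

Section RandomGraphModel.
Context {R : realType} {f : plane R -> R} {Fc : R -> R} {n : nat} {p : R}.
Variables (B : brgg_space f Fc n p) (r : R).
Local Notation P := (prob B).

Lemma measurable_euclid_dist i j :
  measurable_fun setT (fun w => euclid_dist (location B i w) (location B j w)).
Proof.
have mX l : measurable_fun setT (location B l) by apply: measurable_funPT.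
have m1 l : measurable_fun setT (fun w => (location B l w).1 : R).
  exact: (measurableT_comp measurable_fst (mX l)).
have m2 l : measurable_fun setT (fun w => (location B l w).2 : R).
  exact: (measurableT_comp measurable_snd (mX l)).
pose g w : R := ((location B i w).1 - (location B j w).1 : R) ^+ 2 +
                ((location B i w).2 - (location B j w).2 : R) ^+ 2.
have mg : measurable_fun setT g.
  by apply: measurable_funD; apply: measurable_funX; apply: measurable_funB.
exact: (measurableT_comp (continuous_measurable_fun (@sqrt_continuous R)) mg).
Qed.

Lemma fin_measurable_brgg : fin_measurable (brgg (B := B) r).
Proof.
pose g (b : {ffun edge n -> bool * bool}) : {set edge n} := [set e | (b e).1 && (b e).2]%SET.
rewrite (_ : brgg (B := B) r = g \o (fun w => [ffun e : edge n =>
  (euclid_dist (location B (val e).1 w) (location B (val e).2 w) < r, edge_state B e w)])).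
  apply/fin_measurable_comp/fin_measurable_ffun => e; apply: fin_measurable_pair.
    apply: fin_measurable_bool.
    rewrite (_ : [set w | _] = setT `&`
      (fun w => euclid_dist (location B (val e).1 w) (location B (val e).2 w)) @^-1` `]-oo, r[%classic).
      by apply: measurable_euclid_dist => //; apply: measurable_itv.
    by rewrite setTI; apply/seteqP; split => w /=; rewrite in_itv.
  exact: fin_measurable_edge_state.
apply/funext => w; apply/setP => e; rewrite !inE ffunE; done.
Qed.

Lemma measurable_weight A : measurable_fun setT (weight (B := B) A).
Proof.
rewrite (_ : weight A = (fun w => \sum_(e <- enum A) edge_weight B e w)).
  by apply: measurable_sum => e; apply: measurable_funPT.
by apply/funext => w; rewrite big_enum.
Qed.

Variable rule : forall n : nat, {set edge n} -> {set 'I_n}.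

Lemma measurable_tau : measurable_fun setT (tau B r rule).
Proof.
apply: measurable_bigmax => A; last exact: measurable_weight.
exact: (@fin_measurable_set _ _ _ (brgg (B := B) r)
  (fun E => `[< spanning_tree E (rule E) A >]) fin_measurable_brgg).
Qed.

Lemma tau_ge0 w : 0 <= tau B r rule w.
Proof.
rewrite /tau; elim/big_ind: _ => // [x y x0 y0|A _].
  by rewrite le_max x0.
by rewrite sumr_ge0// => e _; have [W0 _] := W_law B e; apply: ltW.
Qed.

Lemma measurable_E_con : measurable (E_con B r).
Proof.
rewrite (_ : E_con B r = [set w | (fun E => `[< connected_on [set: 'I_n]%SET E >]) (brgg (B := B) r w)]).
  exact: (@fin_measurable_set _ _ _ (brgg (B := B) r)
    (fun E => `[< connected_on [set: 'I_n]%SET E >]) fin_measurable_brgg).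
by apply/seteqP; split => w /= /asboolP.
Qed.

Lemma measurable_tau_ge t : measurable [set w | t <= tau B r rule w].
Proof.
rewrite (_ : [set w | _] = setT `&` tau B r rule @^-1` `[t, +oo[%classic).
  by apply: measurable_tau => //; apply: measurable_itv.
by rewrite setTI; apply/seteqP; split => w /=; rewrite in_itv/= andbT.
Qed.

Lemma measurable_tau_le t : measurable [set w | tau B r rule w <= t].
Proof.
rewrite (_ : [set w | _] = setT `&` tau B r rule @^-1` `]-oo, t]%classic).
  by apply: measurable_tau => //; apply: measurable_itv.
by rewrite setTI; apply/seteqP; split => w /=; rewrite in_itv/=.
Qed.

(* Almost sure, but the locations are plane-valued and cells mean nothing outside. *)
Definition in_square (w : sample B) := forall i, unit_square R (location B i w).

Lemma negligible_not_in_square : P.-negligible [set w : sample B | ~ in_square w].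
Proof.
have Ni i : P.-negligible (location B i @^-1` (~` unit_square R)).
  apply/negligibleP; first exact: (measurable_funPTI _ (measurableC (@measurable_unit_square R))).
  exact: (prob_outside_square (X_law B i)).
have Ns (s : seq 'I_n) : P.-negligible
    (\big[setU/set0]_(i <- s) (location B i @^-1` (~` unit_square R))).
  elim: s => [|i s IH]; first by rewrite big_nil; apply: negligible_set0.
  by rewrite big_cons; apply: negligibleU.
apply: negligibleS (Ns (enum 'I_n)) => w /existsNP[i wi].
by rewrite -bigcup_seq; exists i => //=; rewrite mem_enum.
Qed.

(** [Q] is a bad event of the finite model; up to a null set it contains the complement of [A],
    which itself need not be determined by the observations. *)
Lemma prob_ge_model (k : nat) (F : finType) (phi : R -> F)
    (Q : {ffun 'I_n -> cell k} -> {ffun edge n -> bool * F} -> bool)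
    (A : set (sample B)) (e : R) :
  fin_measurable phi -> measurable A ->
  (forall w, in_square w -> ~~ Q (loc_obs (@cell_of R k) w) (edge_obs phi w) -> A w) ->
  Ex (loc_law B (@cell_of R k)) (fun kap =>
    Ex (edge_law B phi) (fun bet => (Q kap bet)%:R)) <= e ->
  ((1 - e)%:E <= P A)%E.
Proof.
move=> mphi mA hA hQ.
have mc := @fin_measurable_cell_of R k.
pose S := [set w : sample B | Q (loc_obs (@cell_of R k) w) (edge_obs phi w)].
have mS : measurable S.
  exact: (@fin_measurable_set _ _ _ _ (fun kb => Q kb.1 kb.2) (fin_measurable_obs B mphi mc)).
have [N' [mN' N'0 NN']] := negligible_not_in_square.
have AC : ~` A `<=` N' `|` S.
  move=> w /= nA; case: (pselect (in_square w)) => [sq|nsq]; last by left; apply: NN'.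
  by right; apply: contrapT => /negP nS; apply/nA/hA.
have PAC : (P (~` A) <= e%:E)%E.
  apply: (@le_trans _ _ (P (N' `|` S))).
    by rewrite le_measure ?inE//; [apply: measurableC|apply: measurableU].
  apply: (le_trans (measureU2 _ mN' mS)).
  by rewrite [X in (X + _)%E]N'0 add0e [leLHS](prob_obs B mphi mc Q) lee_fin.
have := probability_setC P (measurableC mA); rewrite setCK => ->.
by rewrite EFinB leeB.
Qed.

Lemma model_graph_sub (k : nat) (F : finType) (phi : R -> F) w :
  0 < r -> 3 < k.+1%:R * r -> in_square w ->
  model_graph (loc_obs (@cell_of R k) w) (edge_obs phi w) \subset brgg (B := B) r w.
Proof.
move=> r0 Kr sq; apply/fintype.subsetP => e; rewrite !inE !ffunE /= => /andP[ce ->].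
by rewrite andbT (close_dist (sq _) (sq _) r0 Kr).
Qed.

Lemma brgg_far (k : nat) w e :
  0 < r -> k.+1%:R * r <= 4 -> in_square w -> e \in brgg (B := B) r w ->
  e \in far_edges 5 (loc_obs (@cell_of R k) w).
Proof.
move=> r0 Kr sq; rewrite !inE !ffunE => /andP[de _].
exact: (dist_close (sq _) (sq _) r0 Kr de).
Qed.

Lemma connected_onS (E E' : {set edge n}) : E \subset E' ->
  connected_on [set: 'I_n]%SET E -> connected_on [set: 'I_n]%SET E'.
Proof. by move=> EE' c u v uT vT; apply: (connect_adjS EE'); apply: c. Qed.

Hypothesis rule_ok : tie_breaking_rule rule.

Lemma rule_connected (E : {set edge n}) : (0 < n)%N ->
  connected_on [set: 'I_n]%SET E -> rule E = [set: 'I_n]%SET.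
Proof.
move=> n0 Ec; have [[x ->] _] := @rule_ok n E n0.
by apply/setP => y; rewrite !inE; apply: Ec.
Qed.

Lemma tau_ge_tree w A : (0 < n)%N -> E_con B r w ->
  spanning_tree (brgg (B := B) r w) [set: 'I_n]%SET A -> weight A w <= tau B r rule w.
Proof.
move=> n0 c At; rewrite /tau; apply: (@le_bigmax_cond _ _ _ _ A _ (fun A => weight A w)).
by rewrite rule_connected//; apply/asboolP.
Qed.

Lemma edge_weight_gt0 e w : 0 < edge_weight B e w.
Proof. by have [W0 _] := W_law B e. Qed.

Lemma tau_ge_heavy (k : nat) (h : R) w : (0 < n)%N -> 0 <= h ->
  0 < r -> 3 < k.+1%:R * r -> in_square w -> E_con B r w ->
  let kap := loc_obs (@cell_of R k) w in
  (forall U : {set 'I_n}, (n <= 2 * #|U|)%N ->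
     exists2 e, e \in same_cell kap U & edge_state B e w && (h < edge_weight B e w)) ->
  n%:R * h / 4 <= tau B r rule w.
Proof.
move=> n0 h0 r0 Kr sq c kap hU.
pose E' := [set e : edge n | [&& kap (val e).1 == kap (val e).2, edge_state B e w & h < edge_weight B e w]]%SET.
have E'E : E' \subset brgg (B := B) r w.
  apply/fintype.subsetP => e; rewrite !inE => /and3P[/eqP ke -> _]; rewrite andbT.
  apply: (close_dist (sq _) (sq _) r0 Kr).
  move: ke; rewrite /kap !ffunE => ->; rewrite /close; lia.
have [|e|e|A At hA] := @heavy_spanning_tree n R _ E' (fun e => edge_weight B e w) h n0 E'E c _ h0.
- move=> V /hU[e]; rewrite inE => /and3P[e1 e2 ek] eh; exists e; split => //.
  by rewrite inE ek.
- exact/ltW/edge_weight_gt0.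
- by rewrite inE => /and3P[_ _ /ltW].
by apply: le_trans hA _; apply: tau_ge_tree.
Qed.

(** Every weight is at most b plus its value if that exceeds b. The first part is counted over the
    at most n edges of the tree, the second over the whole graph, which removes the dependence on
    the tree. *)
Lemma tau_le_excess (b : R) w : 0 <= b ->
  tau B r rule w <= n%:R * b +
    \sum_(e in brgg (B := B) r w) (if b < edge_weight B e w then edge_weight B e w else 0).
Proof.
move=> b0; set X := fun e => if b < edge_weight B e w then edge_weight B e w else 0.
have X0 e : 0 <= X e by rewrite /X; case: ifP => // _; apply/ltW/edge_weight_gt0.
apply: bigmax_le => [|A /asboolP[AE [_ _ _ Aac]]].
  by rewrite addr_ge0 ?mulr_ge0//; apply: sumr_ge0 => e _; apply: X0.
apply: (@le_trans _ _ (\sum_(e in A) (b + X e))).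
  apply: ler_sum => e _; rewrite /X; case: ltP => h; last by rewrite addr0.
  by rewrite lerDr.
rewrite big_split/= lerD//.
  by rewrite sumr_const -[leLHS]mulr_natl ler_wpM2r// ler_nat leq_card_acyclic.
rewrite [leRHS](big_setID A)/= (finset.setIidPr AE) lerDl; apply: sumr_ge0 => e _; apply: X0.
Qed.

End RandomGraphModel.

(** * Bounds for fixed n *)

(** With m = eps1 n / (4 K2), a quarter of the least mean occupation: first the chance of a cell
    below m, then [Ex_disconnected] for that m. *)
Definition disconnect_bound (R : realType) (eps1 : R) (n : nat) (p : R) (k : nat) : R :=
  let K2 : R := #|{: cell k}|%:R in
  K2 * expR (- (eps1 * n%:R / (4 * K2))) +
  K2 ^+ 2 * (2 * n%:R * expR (- (p * (eps1 * n%:R / (4 * K2)) / 2))).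

Section Bounds.
Context {R : realType} (f : plane R -> R) (Fc : R -> R) (eps1 eps2 : R).
Hypothesis eps1_gt0 : 0 < eps1.
Hypothesis f_density : square_density f.
Hypothesis f_bounds : forall x, unit_square R x -> eps1 <= f x <= eps2.
Context {n : nat} {p : R}.
Hypothesis p01 : 0 < p < 1.
Variables (B : brgg_space f Fc n p) (k : nat).
Local Notation P := (prob B).
Local Notation K2 := (#|{: cell k}|%:R : R).
Local Notation nu := (loc_law B (@cell_of R k)).

Lemma card_cellE : K2 = k.+1%:R ^+ 2.
Proof. by rewrite card_prod card_ord natrM expr2. Qed.

Lemma card_cell_gt0 : 0 < K2.
Proof. by rewrite card_cellE exprn_gt0 ?ltr0n. Qed.

Lemma loc_law_bounds i c : eps1 / K2 <= nu i c <= eps2 / K2.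
Proof.
have /andP[h1 h2] := prob_cell eps1_gt0 f_density f_bounds (X_law B i) c.
rewrite card_cellE /loc_law.
have fK : P (location B i @^-1` (@cell_of R k @^-1` [set c])) \is a fin_num.
  by apply: fin_num_measure; apply: fin_measurable_location; apply: fin_measurable_cell_of.
by rewrite -!lee_fin fineK// h1 h2.
Qed.

Lemma Ex_cell_deficit :
  Ex nu (fun kap => [exists c, (count_at R c kap < eps1 * n%:R / (4 * K2))%R]%:R) <=
  K2 * expR (- (eps1 * n%:R / (4 * K2))).
Proof.
have nu0 := loc_law_ge0 B (@cell_of R k).
have nu1 := loc_law1 B (@fin_measurable_cell_of R k).
apply: le_trans (Ex_exists nu0 _) _.
rewrite [leRHS](_ : _ = \sum_(c : cell k) expR (- (eps1 * n%:R / (4 * K2)))); last by rewrite sumr_const mulr_natl.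
apply: ler_sum => c _.
apply: le_trans (Ex_count_lt nu0 nu1 (q := eps1 / K2) _ _) _.
  by move=> i; case/andP: (loc_law_bounds i c).
rewrite card_ord ler_expR le_eqVlt; apply/orP; left; apply/eqP.
by field; rewrite gt_eqF// card_cell_gt0.
Qed.

(** The threshold is 4 times the largest mean, because [Ex_count_gt] loses 3 times the mean. *)
Lemma Ex_cell_excess :
  Ex nu (fun kap => [exists c, (4 * eps2 * n%:R / K2 < count_at R c kap)%R]%:R) <=
  K2 * expR (- (eps2 * n%:R / K2)).
Proof.
have nu0 := loc_law_ge0 B (@cell_of R k).
have nu1 := loc_law1 B (@fin_measurable_cell_of R k).
apply: le_trans (Ex_exists nu0 _) _.
rewrite [leRHS](_ : _ = \sum_(c : cell k) expR (- (eps2 * n%:R / K2))); last by rewrite sumr_const mulr_natl.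
apply: ler_sum => c _.
apply: le_trans (Ex_count_gt nu0 nu1 (q := eps2 / K2) _ _) _.
  by move=> i; case/andP: (loc_law_bounds i c).
rewrite card_ord ler_expR le_eqVlt; apply/orP; left; apply/eqP.
by field; rewrite gt_eqF// card_cell_gt0.
Qed.

Variables (F : finType) (phi : R -> F).
Hypothesis mphi : fin_measurable phi.
Local Notation mu := (edge_law B phi).

Lemma sum_edge_open e : \sum_(a | a.1) mu e a = p.
Proof.
rewrite (eq_bigl (fun a => (a.1 == true) && predT a.2)); last by move=> [[] a].
rewrite (sum_edge_law B mphi)/= (_ : [set w | _] = setT) ?probability_setT/= ?mulr1//.
by apply/seteqP.
Qed.

Definition disconnected (kap : {ffun 'I_n -> cell k}) (bet : {ffun edge n -> bool * F}) :=
  ~~ `[< connected_on [set: 'I_n]%SET (model_graph kap bet) >].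

Lemma Ex_Ex_disconnected : (0 < n)%N ->
  n%:R * expR (- (p * (eps1 * n%:R / (4 * K2)) / 2)) <= 2^-1 ->
  Ex nu (fun kap => Ex mu (fun bet => (disconnected kap bet)%:R)) <= disconnect_bound eps1 n p k.
Proof.
move=> n0 hx; have nu0 := loc_law_ge0 B (@cell_of R k).
have nu1 := loc_law1 B (@fin_measurable_cell_of R k).
have mu0 e a : 0 <= mu e a by apply: edge_law_ge0.
have mu1 := edge_law1 B mphi.
have p0 : 0 <= p by case/andP: p01 => /ltW.
have m0 : 0 < eps1 * n%:R / (4 * K2) by apply: divr_gt0; apply: mulr_gt0; rewrite ?card_cell_gt0 ?ltr0n.
have x0 := expR_ge0 (- (p * (eps1 * n%:R / (4 * K2)) / 2)).
rewrite /disconnect_bound /=; set y := K2 ^+ 2 * _.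
have y0 : 0 <= y by rewrite !mulr_ge0 ?sqr_ge0.
rewrite -[y in leRHS](Ex_cst nu1).
apply: le_trans (lerD Ex_cell_deficit (lexx _)).
rewrite -ExD; apply: (le_Ex nu0) => kap.
(* A deficient cell map is charged 1, absorbed by its indicator; on the others the disconnection
   bound is uniform. *)
case: existsP => [_|ncell] /=.
  apply: (@le_trans _ _ (Ex mu (fun=> 1))); last by rewrite (Ex_cst mu1) lerDl.
  by apply: (le_Ex mu0) => bet; case: disconnected.
rewrite add0r; apply: (Ex_disconnected mu0 mu1 p0 m0) => //.
  by move=> e; rewrite sum_edge_open.
by move=> c; rewrite leNgt; apply/negP => h; apply: ncell; exists c.
Qed.

End Bounds.

Lemma fin_measurable_level_id (R : realType) (t : nat -> R) J : fin_measurable (level t J).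
Proof. exact: (@fin_measurable_level R t J _ _ id (@measurable_id _ _ _)). Qed.

(** * Lower bound in probability *)

Section LowerBound.
Context {R : realType} (f : plane R -> R) (Fc : R -> R) (eps1 eps2 : R).
Hypothesis eps1_gt0 : 0 < eps1.
Hypothesis f_density : square_density f.
Hypothesis f_bounds : forall x, unit_square R x -> eps1 <= f x <= eps2.
Context {n : nat} {p : R}.
Hypothesis p01 : 0 < p < 1.
Hypothesis Fc_ccdf : is_positive_ccdf Fc.
Variables (B : brgg_space f Fc n p) (k : nat).
Local Notation P := (prob B).
Local Notation K2 := (#|{: cell k}|%:R : R).

Lemma prob_weight_gt e x : 0 < x -> P [set w | x < edge_weight B e w] = (Fc x)%:E.
Proof.
move=> x0; have [_ <-//] := W_law B e; rewrite /ccdf /distribution /pushforward /=.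
by congr (P _); apply/seteqP; split => w /=; rewrite in_itv/= andbT.
Qed.

Lemma prob_tau_ge (r : R) (rule : forall n : nat, {set edge n} -> {set 'I_n}) (h : R) :
  tie_breaking_rule rule -> (0 < n)%N -> 0 < r -> 3 < k.+1%:R * r -> 0 < h ->
  n%:R * expR (- (p * (eps1 * n%:R / (4 * K2)) / 2)) <= 2^-1 ->
  ((1 - (disconnect_bound eps1 n p k +
     expR (n%:R - p * Fc h * (n%:R ^+ 2 / (8 * K2) - n%:R / 2))))%:E <=
   P (E_con B r `&` [set w | (n%:R * h / 4 <= tau B r rule w)%R]))%E.
Proof.
move=> rule_ok n0 r0 Kr h0 hx.
(* A single threshold: positive level means weight above h. *)
pose phi := level (fun _ => h) 1.
have mphi : fin_measurable phi := @fin_measurable_level_id R (fun _ => h) 1.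
have phiE x : (0 < phi x)%N = (h < x) by apply: ltn_level.
pose heavy (a : bool * 'I_2) := a.1 && (0 < a.2)%N.
pose sparse (kap : {ffun 'I_n -> cell k}) (bet : {ffun edge n -> bool * 'I_2}) :=
  [exists U : {set 'I_n}, (n <= 2 * #|U|)%N && [forall e in same_cell kap U, ~~ heavy (bet e)]].
have mu0 e a : 0 <= edge_law B phi e a by apply: edge_law_ge0.
have mu1 := edge_law1 B mphi.
have nu0 := loc_law_ge0 B (@cell_of R k).
have nu1 := loc_law1 B (@fin_measurable_cell_of R k).
apply: (@prob_ge_model _ _ _ _ _ B k _ phi (fun kap bet => disconnected kap bet || sparse kap bet)) => //.
- by apply: measurableI; [apply: measurable_E_con|apply: measurable_tau_ge].
- move=> w sq; rewrite negb_or => /andP[/negPn/asboolP con nsp].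
  have Ec : E_con B r w.
    by apply: connected_onS con; apply: model_graph_sub.
  split => //=; apply: (tau_ge_heavy rule_ok n0 (ltW h0) r0 Kr sq Ec).
  move=> U nU; move: nsp => /existsPn/(_ U); rewrite nU /= negb_forall => /existsP[e].
  rewrite negb_imply negbK => /andP[eU]; rewrite /heavy ffunE /= phiE => eh.
  by exists e.
- apply: le_trans (lerD (Ex_Ex_disconnected eps1_gt0 f_density f_bounds p01 B mphi n0 hx) (lexx _)).
  rewrite -[expR _ in leRHS](Ex_cst nu1) -ExD; apply: (le_Ex nu0) => kap.
  have q0 : 0 <= p * Fc h.
    rewrite mulr_ge0//; first by case/andP: p01 => /ltW.
    exact: ccdf_ge0 Fc_ccdf _ h0.
  have sp : forall e, p * Fc h <= \sum_(a | heavy a) edge_law B phi e a.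
    move=> e; rewrite (eq_bigl (fun a : bool * 'I_2 => (a.1 == true) && (fun i : 'I_2 => (0 < i)%N) a.2)); last first.
      by move=> [[] a].
    rewrite [leRHS](sum_edge_law B mphi e true (fun i : 'I_2 => (0 < i)%N))/=.
    have -> : [set w | (0 < phi (edge_weight B e w))%N] = [set w | h < edge_weight B e w].
      by apply/seteqP; split => w /=; rewrite phiE.
    by rewrite prob_weight_gt.
  apply: le_trans (lerD (lexx _) (Ex_sparse mu0 mu1 kap q0 sp)).
  rewrite -ExD; apply: (le_Ex mu0) => bet; rewrite -/(sparse kap bet).
  by case: disconnected; case: sparse; rewrite /= ?addr0 ?add0r ?lerDl.
Qed.
End LowerBound.

Lemma expectation_ge_prob (R : realType) d (T : measurableType d) (P : probability T R)
    (X : T -> R) (A : set T) (t e : R) : measurable_fun setT X -> (forall w, 0 <= X w) ->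
  measurable A -> 0 <= t -> (forall w, A w -> t <= X w) -> (e%:E <= P A)%E ->
  ((t * e)%:E <= 'E_P[X])%E.
Proof.
move=> mX X0 mA t0 tX eA; rewrite unlock.
apply: (@le_trans _ _ (\int[P]_(w in A) (cst t%:E w))%E).
  by rewrite integral_cst// EFinM lee_wpmul2l// lee_fin.
apply: (@le_trans _ _ (\int[P]_(w in A) (X w)%:E)%E).
  apply: ge0_le_integral => //.
  - by apply/measurable_EFinP; apply: measurable_funTS.
apply: ge0_subset_integral => //.
- by apply/measurable_EFinP.
- by move=> w _; rewrite lee_fin.
Qed.

Lemma sum_geometric_le (R : realType) (x : R) m : 0 < x < 1 ->
  \sum_(j < m) x ^+ j <= (1 - x)^-1.
Proof.
move=> /andP[x0 x1]; have x1' : 0 < 1 - x by lra.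
rewrite -(ler_pM2l x1') divff ?gt_eqF//.
suff -> : (1 - x) * \sum_(j < m) x ^+ j = 1 - x ^+ m.
  by rewrite gerBl exprn_ge0 ?ltW.
elim: m => [|m IH]; first by rewrite big_ord0 expr0 mulr0 subrr.
by rewrite big_ord_recr/= mulrDr IH exprS; ring.
Qed.

(** * Upper bound in probability *)

Section UpperBound.
Context {R : realType} (f : plane R -> R) (Fc : R -> R) (eps1 eps2 : R).
Hypothesis eps1_gt0 : 0 < eps1.
Hypothesis f_density : square_density f.
Hypothesis f_bounds : forall x, unit_square R x -> eps1 <= f x <= eps2.
Context {n : nat} {p : R}.
Hypothesis p01 : 0 < p < 1.
Variables (B : brgg_space f Fc n p) (k : nat).
Local Notation P := (prob B).
Local Notation K2 := (#|{: cell k}|%:R : R).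
Variables (b rho C1 L : R).
Hypothesis b_gt0 : 0 < b.
Hypothesis rho01 : 0 < rho < 1.
Hypothesis C1_ge0 : 0 <= C1.
Hypothesis L_ge0 : 0 <= L.
(** Applied with L = 1/D, the bound on [Fc b] for b above H(D). *)
Hypothesis tailF : forall j, Fc (2 ^+ j * b) <= C1 * (rho / 4) ^+ j * L.

(* On level j > 0 the weight is in ]2^(j-1) b, 2^j b], unless j = J is the top level. *)
Definition excess (J : nat) (a : bool * 'I_J.+1) : R :=
  if a.1 && (0 < a.2)%N then 2 ^+ a.2 * b else 0.

Definition dyadic (j : nat) : R := 2 ^+ j * b.

Lemma dyadic_homo : {homo dyadic : i j / (i <= j)%N >-> i <= j}.
Proof. by move=> i j ij; rewrite ler_pM2r// ler_eXn2l ?ltr1n. Qed.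

Lemma excess_ge0 J a : 0 <= @excess J a.
Proof. by rewrite /excess; case: ifP => // _; rewrite mulr_ge0 ?exprn_ge0// ltW. Qed.

(** A nonzero excess is at least b, so the first moment follows from the second. *)
Lemma excess_le_sqr J a : @excess J a <= excess a ^+ 2 / b.
Proof.
rewrite /excess; case: ifP => _; last by rewrite expr0n mul0r.
rewrite ler_pdivlMr// expr2 ler_wpM2l ?mulr_ge0 ?exprn_ge0 ?(ltW b_gt0)//.
by rewrite ler_peMl ?(ltW b_gt0)// exprn_ege1// ler1n.
Qed.

Variable J : nat.
Hypothesis J_gt0 : (0 < J)%N.
Local Notation phi := (level dyadic J).
Local Notation mu := (edge_law B phi).

Lemma fin_measurable_dyadic_level : fin_measurable phi. Proof. exact: fin_measurable_level_id. Qed.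

Lemma prob_level_le e (j : nat) (S : pred 'I_J.+1) :
  (forall i, S i -> (j < i)%N) -> (j < J)%N ->
  fine (P [set w | S (phi (edge_weight B e w))]) <= C1 * (rho / 4) ^+ j * L.
Proof.
move=> Sj jJ; apply: le_trans (tailF j).
have mS : measurable [set w | S (phi (edge_weight B e w))].
  exact: (@fin_measurable_set _ _ _ _ S (fin_measurable_edge_weight B fin_measurable_dyadic_level e)).
have mgt : measurable [set w | dyadic j < edge_weight B e w].
  rewrite (_ : [set w | _] = edge_weight B e @^-1` `]dyadic j, +oo[%classic).
    by apply: measurable_funPTI; apply: measurable_itv.
  by apply/seteqP; split => w /=; rewrite in_itv/= andbT.
have d0 : 0 < dyadic j by rewrite mulr_gt0 ?exprn_gt0.
rewrite -lee_fin fineK ?fin_num_measure// -(prob_weight_gt B e d0).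
rewrite le_measure ?inE// => w /= /Sj.
by rewrite ltn_level//; apply: dyadic_homo.
Qed.

(** Level j + 1 contributes at most (2^(j+1) b)^2 C1 (rho/4)^j L = 4 C1 L b^2 rho^j, a geometric
    series. *)
Lemma excess_second_moment e :
  \sum_a mu e a * excess a ^+ 2 <= p * (4 * C1 * L * b ^+ 2 / (1 - rho)).
Proof.
have /andP[rho0 rho1] := rho01; have p0 : 0 <= p by case/andP: p01 => /ltW.
rewrite -(pair_big xpredT xpredT (fun z i => mu e (z, i) * excess (z, i) ^+ 2))/=.
rewrite big_bool /= [X in _ + X]big1 ?addr0; last by move=> i _; rewrite /excess/= expr0n mulr0.
rewrite big_ord_recl /excess/= ?expr0n ?mulr0 add0r.
apply: (@le_trans _ _ (\sum_(i < J) p * (4 * C1 * L * b ^+ 2) * rho ^+ i)); last first.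
  rewrite -mulr_sumr [leRHS]mulrA ler_wpM2l ?sum_geometric_le//.
  by rewrite mulr_ge0// mulr_ge0 ?sqr_ge0// mulr_ge0// mulr_ge0// ler0n.
apply: ler_sum => i _; rewrite /edge_law /= /bump leq0n add1n -[leLHS]mulrA -[leRHS]mulrA ler_wpM2l//.
rewrite (_ : edge_weight B e @^-1` _ = [set w | pred1 (lift ord0 i) (phi (edge_weight B e w))]); last first.
  by apply/seteqP; split => w /= /eqP.
have hq := @prob_level_le e i (pred1 (lift ord0 i)) _ (ltn_ord i).
have {}hq := hq ltac:(by move=> j /eqP ->; rewrite lift0).
apply: (@le_trans _ _ (C1 * (rho / 4) ^+ i * L * (2 ^+ i.+1 * b) ^+ 2)).
  by apply: ler_wpM2r; [apply: sqr_ge0|apply: hq].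
rewrite le_eqVlt; apply/orP; left; apply/eqP.
have e4 : 2 ^+ 2 = 4 :> R by rewrite expr2; lra.
rewrite [X in _ * X = _]exprMn exprAC e4 expr_div_n exprS.
by field; rewrite expf_neq0.
Qed.

Lemma excess_first_moment e :
  \sum_a mu e a * excess a <= p * (4 * C1 * L * b / (1 - rho)).
Proof.
have := excess_second_moment e; rewrite -(ler_pM2r (_ : 0 < b^-1)) ?invr_gt0// mulr_suml => h.
have mu0 a : 0 <= mu e a by apply: edge_law_ge0.
apply: le_trans (le_trans _ h) _.
  apply: ler_sum => a _; rewrite -[leRHS]mulrA ler_wpM2l//; exact: excess_le_sqr.
have /andP[rho0 rho1] := rho01.
have b0 : b != 0 by rewrite gt_eqF.
have r0 : 1 - rho != 0 by rewrite gt_eqF// subr_gt0.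
by rewrite le_eqVlt; apply/orP; left; apply/eqP; field; rewrite b0 r0.
Qed.

Lemma card_edge_le : (#|{: edge n}| <= n ^ 2)%N.
Proof.
rewrite -(card_imset _ (@val_inj _ _ (edge n))) (leq_trans (max_card _))//.
by rewrite card_prod card_ord mulnn.
Qed.

Definition top_level (bet : {ffun edge n -> bool * 'I_J.+1}) :=
  [exists e, (bet e).2 == ord_max].

(** On the top level [excess] does not dominate the weight, so reaching it is a bad event; a large J
    makes it rare even for all edges together. *)
Lemma Ex_top_level :
  Ex mu (fun bet => (top_level bet)%:R) <= n%:R ^+ 2 * (C1 * (rho / 4) ^+ J.-1 * L).
Proof.
have mu0 e a : 0 <= mu e a by apply: edge_law_ge0.
have mu1 := edge_law1 B fin_measurable_dyadic_level.
have /andP[rho0 rho1] := rho01.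
apply: le_trans (Ex_exists mu0 _) _.
apply: (@le_trans _ _ (\sum_(e : edge n) C1 * (rho / 4) ^+ J.-1 * L)); last first.
  rewrite sumr_const -[leLHS]mulr_natl -natrX ler_wpM2r ?ler_nat ?card_edge_le//.
  by rewrite !mulr_ge0 ?exprn_ge0 ?divr_ge0// ltW.
apply: ler_sum => e _.
rewrite (Ex_coord mu1 e (fun a => (a.2 == ord_max)%:R)).
have hq := @prob_level_le e J.-1 (pred1 ord_max) _ _.
have {}hq := hq ltac:(by move=> i /eqP ->; rewrite /= prednK) ltac:(by rewrite prednK).
apply: le_trans _ hq; rewrite le_eqVlt; apply/orP; left; apply/eqP.
rewrite (bigID (fun a => a.1 == true))/=.
transitivity (\sum_(a | (a.1 == true) && pred1 ord_max a.2) mu e a +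
              \sum_(a | (a.1 == false) && pred1 ord_max a.2) mu e a).
  congr (_ + _); rewrite [RHS]big_mkcondr; apply: eq_big => [[[] a]|[[] a] _]//=;
    by case: eqP; rewrite ?mulr1 ?mulr0.
rewrite (sum_edge_law B fin_measurable_dyadic_level e true (pred1 ord_max)).
rewrite (sum_edge_law B fin_measurable_dyadic_level e false (pred1 ord_max)) /=.
by rewrite -mulrDl addrC subrK mul1r.
Qed.

Definition crowded (kap : {ffun 'I_n -> cell k}) :=
  [exists c, (4 * eps2 * n%:R / K2 < count_at R c kap)%R].

(** Bounds the number of candidate edges when no cell is crowded; 121 = (2 * 5 + 1)^2 counts the
    cells within 5. *)
Let far : R := n%:R * (121 * (4 * eps2 * n%:R / K2)).
Let s1 : R := p * (4 * C1 * L * b / (1 - rho)).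
Let s2 : R := p * (4 * C1 * L * b ^+ 2 / (1 - rho)).

Lemma Ex_excess kap v : 0 < v -> ~~ crowded kap ->
  Ex mu (fun bet => (far * s1 + v < \sum_(e in far_edges 5 kap) excess (bet e))%R%:R)
  <= far * s2 / v ^+ 2.
Proof.
move=> v0 /existsPn ncr.
have mu0 e a : 0 <= mu e a by apply: edge_law_ge0.
have mu1 := edge_law1 B fin_measurable_dyadic_level.
have /andP[rho0 rho1] := rho01; have p0 : 0 <= p by case/andP: p01 => /ltW.
have hfar : #|far_edges 5 kap|%:R <= far.
  by apply: card_far_edges => c; rewrite leNgt; apply: ncr.
have s10 : 0 <= s1.
  by rewrite mulr_ge0// divr_ge0 ?subr_ge0 ?(ltW rho1)// !mulr_ge0// ltW.
have s20 : 0 <= s2.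
  by rewrite mulr_ge0// divr_ge0 ?subr_ge0 ?(ltW rho1)// mulr_ge0 ?sqr_ge0// !mulr_ge0.
apply: le_trans (@Ex_chebyshev _ _ _ _ mu0 mu1 (far_edges 5 kap) (fun _ a => excess a) s2 (far * s1) v v0 _ _) _.
- by move=> e _; apply: excess_second_moment.
- apply: (@le_trans _ _ (\sum_(e in far_edges 5 kap) s1)).
    by apply: ler_sum => e _; apply: excess_first_moment.
  by rewrite sumr_const -[leLHS]mulr_natl ler_wpM2r.
- by rewrite ler_pM2r ?invr_gt0 ?exprn_gt0// ler_wpM2r.
Qed.

Lemma tau_le_of_excess (r : R) (rule : forall n : nat, {set edge n} -> {set 'I_n}) (t : R) w :
  0 < r -> k.+1%:R * r <= 4 -> in_square w ->
  ~~ top_level (edge_obs phi w) ->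
  \sum_(e in far_edges 5 (loc_obs (@cell_of R k) w)) excess (edge_obs phi w e) <= t ->
  tau B r rule w <= n%:R * b + t.
Proof.
move=> r0 Kr sq ntop ht.
apply: le_trans (tau_le_excess _ _ _ (ltW b_gt0)) _; rewrite lerD2l; apply: le_trans ht.
have sub : brgg (B := B) r w \subset far_edges 5 (loc_obs (@cell_of R k) w).
  by apply/fintype.subsetP => e; apply: brgg_far.
rewrite [leRHS](big_setID (brgg (B := B) r w))/= (finset.setIidPr sub).
rewrite -[leLHS]addr0 lerD//; last by apply: sumr_ge0 => e _; apply: excess_ge0.
apply: ler_sum => e eE; case: ltP => [bW|_]; last exact: excess_ge0.
have Ze : edge_state B e w by move: eE; rewrite inE => /andP[].
rewrite /excess ffunE /= Ze /=.
move: ntop => /existsPn/(_ e); rewrite ffunE /= -val_eqE /= => iJ.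
have lvl := @ltn_level R dyadic J (edge_weight B e w) ^~ dyadic_homo.
rewrite lvl// {1}/dyadic expr0 mul1r bW.
(* Below the top level, threshold number i exists and is not exceeded by a weight of level i, which
   is therefore at most 2^i b. *)
have iJ' : (phi (edge_weight B e w) < J)%N.
  by rewrite ltn_neqAle iJ -ltnS ltn_ord.
by have := lvl _ iJ'; rewrite ltnn => /esym/negbT; rewrite -leNgt.
Qed.

Lemma prob_tau_le (r : R) (rule : forall n : nat, {set edge n} -> {set 'I_n}) (v : R) :
  (0 < n)%N -> 0 < r -> 3 < k.+1%:R * r <= 4 -> 0 < v ->
  n%:R * expR (- (p * (eps1 * n%:R / (4 * K2)) / 2)) <= 2^-1 ->
  ((1 - (disconnect_bound eps1 n p k + K2 * expR (- (eps2 * n%:R / K2)) +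
     n%:R ^+ 2 * (C1 * (rho / 4) ^+ J.-1 * L) + far * s2 / v ^+ 2))%:E <=
   P (E_con B r `&` [set w | (tau B r rule w <= n%:R * b + (far * s1 + v))%R]))%E.
Proof.
move=> n0 r0 /andP[Kr Kr4] v0 hx.
have mu0 e a : 0 <= mu e a by apply: edge_law_ge0.
have mu1 := edge_law1 B fin_measurable_dyadic_level.
have nu0 := loc_law_ge0 B (@cell_of R k).
have nu1 := loc_law1 B (@fin_measurable_cell_of R k).
pose exc (kap : {ffun 'I_n -> cell k}) (bet : {ffun edge n -> bool * 'I_J.+1}) :=
  (far * s1 + v < \sum_(e in far_edges 5 kap) excess (bet e))%R.
pose Q kap bet := [|| disconnected kap bet, crowded kap, top_level bet | exc kap bet].
apply: (@prob_ge_model _ _ _ _ _ B k _ phi Q).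
- exact: fin_measurable_dyadic_level.
- by apply: measurableI; [apply: measurable_E_con|apply: measurable_tau_le].
- move=> w sq; rewrite !negb_or => /and4P[/negPn/asboolP con _ ntop nexc].
  split; first by apply: connected_onS con; apply: model_graph_sub.
  by rewrite /=; apply: tau_le_of_excess => //; rewrite leNgt.
set e1 := n%:R ^+ 2 * _; set e2 := far * s2 / _.
rewrite -addrA -[e1 + e2](Ex_cst nu1).
apply: le_trans (lerD (lerD (Ex_Ex_disconnected eps1_gt0 f_density f_bounds p01 B fin_measurable_dyadic_level n0 hx)
  (Ex_cell_excess eps1_gt0 f_density f_bounds B k)) (lexx _)).
rewrite -!ExD; apply: (le_Ex nu0) => kap; rewrite -/(crowded kap).
have e10 : 0 <= e1 by apply: le_trans Ex_top_level; rewrite -[leLHS](Ex_cst mu1); apply: (le_Ex mu0).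
have d0 : 0 <= Ex mu (fun bet => (disconnected kap bet)%:R).
  by rewrite -[leLHS](Ex_cst mu1); apply: (le_Ex mu0).
(* A crowded map is charged 1, absorbed by its own indicator; otherwise [Ex_excess] applies. *)
case: (boolP (crowded kap)) => cr /=.
  have e20 : 0 <= e2.
    have /andP[rho0 rho1] := rho01; have p0 : 0 <= p by case/andP: p01 => /ltW.
    have eps20 : 0 <= eps2.
      have /f_bounds/andP[h1 h2] : unit_square R (0, 0) by split; rewrite /= lexx ler01.
      exact: ltW (lt_le_trans eps1_gt0 (le_trans h1 h2)).
    have far0 : 0 <= far by rewrite mulr_ge0// mulr_ge0// divr_ge0// !mulr_ge0.
    rewrite divr_ge0 ?sqr_ge0// mulr_ge0// mulr_ge0// divr_ge0 ?subr_ge0 ?(ltW rho1)//.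
    by rewrite mulr_ge0 ?sqr_ge0// !mulr_ge0.
  apply: (@le_trans _ _ 1); last by lra.
  by rewrite -[leRHS](Ex_cst mu1); apply: (le_Ex mu0) => bet; case: (Q _ _).
apply: le_trans (lerD (lexx _) (lerD Ex_top_level (Ex_excess v0 cr))).
rewrite addr0 -!ExD; apply: (le_Ex mu0) => bet; rewrite /Q (negbTE cr) /= -/(exc kap bet).
by case: disconnected; case: top_level; case: (exc kap bet) => /=; lra.
Qed.

End UpperBound.

(** * Integrals of layered majorants *)

Section Layers.
Context d (T : measurableType d) (R : realType) (P : probability T R).
Variables (D : nat -> set T) (c : nat -> R).
Hypothesis mD : forall j, measurable (D j).
Hypothesis c_ge0 : forall j, 0 <= c j.

Definition layers (w : T) : \bar R := (\sum_(0 <= j <oo) (c j)%:E * (\1_(D j) w)%:E)%E.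

Lemma layers_term_ge0 j w : (0 <= (c j)%:E * (\1_(D j) w)%:E)%E.
Proof. by rewrite mule_ge0// lee_fin// indicE. Qed.

Lemma measurable_layers_term j :
  measurable_fun setT (fun w => ((c j)%:E * (\1_(D j) w)%:E)%E).
Proof.
apply/measurable_EFinP; apply: measurable_funM => //; exact: measurable_indic.
Qed.

Lemma layers_ge0 w : (0 <= layers w)%E.
Proof. by apply: nneseries_ge0 => j _ _; apply: layers_term_ge0. Qed.

Lemma layers_ge j w : D j w -> ((c j)%:E <= layers w)%E.
Proof.
move=> Dj; apply: le_trans (nneseries_lim_ge (m := 0) (P := xpredT) j.+1 _); last first.
  by move=> i _ _; apply: layers_term_ge0.
rewrite big_nat_recr//= indicE mem_set// mule1 leeDr// sume_ge0// => i _.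
exact: layers_term_ge0.
Qed.

Lemma measurable_layers : measurable_fun setT layers.
Proof.
by apply: ge0_emeasurable_sum => [j w _ _|j _];
  [apply: layers_term_ge0|apply: measurable_layers_term].
Qed.

Lemma integral_layers_le (M : R) :
  (forall m, \sum_(j < m) c j * fine (P (D j)) <= M) ->
  (\int[P]_w layers w <= M%:E)%E.
Proof.
move=> hM; rewrite integral_nneseries//; last 2 first.
- by move=> j; apply: measurable_layers_term.
- by move=> j w _; apply: layers_term_ge0.
have term j : (\int[P]_w ((c j)%:E * (\1_(D j) w)%:E) = (c j * fine (P (D j)))%:E)%E.
  rewrite ge0_integralZl_EFin//.
  - by rewrite integral_indic// setIT EFinM fineK// fin_num_measure.
  - by apply/measurable_EFinP; apply: measurable_indic.
apply: lime_le.
  by apply: is_cvg_nneseries => j _ _; apply: integral_ge0 => w _; apply: layers_term_ge0.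
apply: nearW => m; rewrite big_mkord (eq_bigr (fun j : 'I_m => (c j * fine (P (D j)))%:E)) => [|j _]; last exact: term.
by rewrite sumEFin lee_fin; apply: hM.
Qed.

End Layers.

(** * Upper bound in expectation *)

Section UpperExpectation.
Context {R : realType} (f : plane R -> R) (Fc : R -> R) (eps1 eps2 : R).
Hypothesis eps1_gt0 : 0 < eps1.
Hypothesis f_density : square_density f.
Hypothesis f_bounds : forall x, unit_square R x -> eps1 <= f x <= eps2.
Context {n : nat} {p : R}.
Hypothesis p01 : 0 < p < 1.
Hypothesis Fc_ccdf : is_positive_ccdf Fc.
Variables (B : brgg_space f Fc n p) (k : nat).
Local Notation P := (prob B).
Local Notation K2 := (#|{: cell k}|%:R : R).
Local Notation nu := (loc_law B (@cell_of R k)).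

Lemma eps2_ge0 : 0 <= eps2.
Proof.
have /f_bounds/andP[h1 h2] : unit_square R (0, 0) by split; rewrite /= lexx ler01.
exact: ltW (lt_le_trans eps1_gt0 (le_trans h1 h2)).
Qed.

(** Summing over the cell of u separates the two independent locations; v then has at most 121 cells
    to fall into. *)
Lemma Ex_close (u v : 'I_n) : u != v ->
  Ex nu (fun kap => (close 5 (kap u) (kap v))%:R) <= 121 * (eps2 / K2).
Proof.
move=> uv; have vu : (v == u) = false by rewrite eq_sym (negbTE uv).
have nu0 := loc_law_ge0 B (@cell_of R k).
have nu1 := loc_law1 B (@fin_measurable_cell_of R k).
pose Y c (i : 'I_n) (a : cell k) : R := if i == u then (a == c)%:R else (close 5 c a)%:R.
rewrite (@eq_Ex _ _ _ nu _ (fun kap : {ffun 'I_n -> cell k} => \sum_c Y c u (kap u) * Y c v (kap v))); last first.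
  move=> kap; rewrite (bigD1 (kap u))//= [X in _ + X]big1 ?addr0.
    by rewrite /Y vu !eqxx mul1r.
  by move=> c; rewrite /Y eqxx eq_sym => /negbTE ->; rewrite mul0r.
rewrite Ex_sum.
have K20 := @card_cell_gt0 R k.
apply: (@le_trans _ _ (\sum_c nu u c * (121 * (eps2 / K2)))); last first.
  by rewrite -mulr_suml nu1 mul1r.
apply: ler_sum => c _; rewrite Ex_coord2// {1}/Y eqxx.
rewrite (bigD1 c)//= eqxx mulr1 [X in _ + X]big1 ?addr0; last by move=> a /negbTE ->; rewrite mulr0.
rewrite ler_wpM2l// /Y vu.
apply: (@le_trans _ _ (\sum_(a | close 5 c a) eps2 / K2)).
  rewrite [leRHS]big_mkcond; apply: ler_sum => a _; case: (close 5 c a); rewrite ?mulr0// mulr1.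
  by case/andP: (loc_law_bounds eps1_gt0 f_density f_bounds B v a).
rewrite sumr_const -[leLHS]mulr_natl ler_wpM2r ?divr_ge0 ?eps2_ge0 ?(ltW K20)//.
by rewrite ler_nat -[X in (X <= _)%N]cardsE; apply: (@card_close k 5 c).
Qed.

Lemma prob_open_heavy_close (e : edge n) (x : R) : 0 < x ->
  fine (P [set w | [&& close 5 (cell_of k (location B (val e).1 w)) (cell_of k (location B (val e).2 w)),
     edge_state B e w & x < edge_weight B e w]]) <= 121 * (eps2 / K2) * (p * Fc x).
Proof.
move=> x0; pose phi := level (fun _ => x) 1.
have mphi : fin_measurable phi := @fin_measurable_level_id R (fun _ => x) 1.
have phiE y : (0 < phi y)%N = (x < y) by apply: ltn_level.
have mu0 i a : 0 <= edge_law B phi i a by apply: edge_law_ge0.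
have mu1 := edge_law1 B mphi.
have nu0 := loc_law_ge0 B (@cell_of R k).
pose Q (kap : {ffun 'I_n -> cell k}) (bet : {ffun edge n -> bool * 'I_2}) :=
  close 5 (kap (val e).1) (kap (val e).2) && ((bet e).1 && (0 < (bet e).2)%N).
have -> : [set w | [&& close 5 (cell_of k (location B (val e).1 w)) (cell_of k (location B (val e).2 w)),
     edge_state B e w & x < edge_weight B e w]] =
     [set w | Q (loc_obs (@cell_of R k) w) (edge_obs phi w)].
  by apply/seteqP; split => w; rewrite /= /Q !ffunE /= phiE.
have := prob_obs B mphi (@fin_measurable_cell_of R k) Q => /= ->; rewrite /=.
have q0 : 0 <= p * Fc x.
  by rewrite mulr_ge0//; [case/andP: p01 => /ltW|exact: ccdf_ge0 Fc_ccdf _ x0].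
have neq : (val e).1 != (val e).2.
  by have := valP e; apply: contraL => /eqP ->; rewrite ltnn.
apply: (@le_trans _ _ (Ex nu (fun kap => p * Fc x * (close 5 (kap (val e).1) (kap (val e).2))%:R))).
  apply: (le_Ex nu0) => kap; rewrite /Q; case: close => /=; last first.
    by rewrite (Ex_cst mu1) mulr0.
  rewrite mulr1 (Ex_coord mu1 e (fun a : bool * 'I_2 => (a.1 && (0 < a.2)%N)%:R)).
  rewrite (_ : \sum_a _ = \sum_(a | (a.1 == true) && (fun i : 'I_2 => (0 < i)%N) a.2) edge_law B phi e a); last first.
    rewrite [RHS]big_mkcond; apply: eq_bigr => -[[] i] _ /=; rewrite ?mulr0//.
    by case: ifP; rewrite ?mulr1 ?mulr0.
  rewrite (sum_edge_law B mphi e true (fun i : 'I_2 => (0 < i)%N))/=.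
  have -> : [set w | (0 < phi (edge_weight B e w))%N] = [set w | x < edge_weight B e w].
    by apply/seteqP; split => w /=; rewrite phiE.
  by rewrite prob_weight_gt.
by rewrite ExZ mulrC ler_wpM2r// Ex_close.
Qed.

Variables (b rho C1 L : R).
Hypothesis b_gt0 : 0 < b.
Hypothesis rho01 : 0 < rho < 1.
Hypothesis C1_ge0 : 0 <= C1.
Hypothesis L_ge0 : 0 <= L.
Hypothesis tailF : forall j, Fc (2 ^+ j * b) <= C1 * (rho / 4) ^+ j * L.

(** The weight of an edge of the graph above b is dominated by [layers] with value 2^(j+1) b on the
    event that it exceeds 2^j b; at most n^2 edges are summed by linearity. *)
Lemma expectation_tau_le (r : R) (rule : forall n : nat, {set edge n} -> {set 'I_n}) :
  0 < r -> k.+1%:R * r <= 4 ->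
  ('E_P[tau B r rule] <= (n%:R * b +
     n%:R ^+ 2 * (121 * (eps2 / K2) * p * C1 * L * (2 * b / (1 - rho))))%:E)%E.
Proof.
move=> r0 Kr4; have K20 := @card_cell_gt0 R k.
have /andP[rho0 rho1] := rho01; have p0 : 0 <= p by case/andP: p01 => /ltW.
(* Adding the null set N' to the events G e j makes the layer bound hold everywhere. *)
have [N' [mN' N'0 NN']] := @negligible_not_in_square _ _ _ _ _ B.
pose G (e : edge n) j := [set w | [&& close 5 (cell_of k (location B (val e).1 w)) (cell_of k (location B (val e).2 w)),
     edge_state B e w & 2 ^+ j * b < edge_weight B e w]].
have d0 j : 0 < 2 ^+ j * b by rewrite mulr_gt0 ?exprn_gt0.
have mG e j : measurable (G e j).
  pose t (_ : nat) := 2 ^+ j * b.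
  have mt := @fin_measurable_level_id R t 1.
  have tE x : (0 < level t 1 x)%N = (2 ^+ j * b < x) by apply: ltn_level.
  have := @fin_measurable_set _ _ _ _ (fun kb : {ffun 'I_n -> cell k} * {ffun edge n -> bool * 'I_2} =>
    [&& close 5 (kb.1 (val e).1) (kb.1 (val e).2), (kb.2 e).1 & (0 < (kb.2 e).2)%N])
    (fin_measurable_obs B mt (@fin_measurable_cell_of R k)).
  by congr measurable; apply/seteqP; split => w; rewrite /= !ffunE /= tE.
pose D e j := N' `|` G e j.
have mD e j : measurable (D e j) by apply: measurableU.
pose c j := 2 ^+ j.+1 * b.
have c0 j : 0 <= c j by rewrite mulr_ge0 ?exprn_ge0// ltW.
set M := 121 * (eps2 / K2) * p * C1 * L * (2 * b / (1 - rho)).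
have f0 : 0 <= 121 * (eps2 / K2) * p * C1 * L.
  by rewrite !mulr_ge0 ?invr_ge0 ?eps2_ge0 ?(ltW K20).
have f0b : 0 <= 121 * (eps2 / K2) * p * C1 * L * (2 * b).
  by rewrite mulr_ge0// mulr_ge0// ltW.
have M0 : 0 <= M.
  by rewrite mulr_ge0// divr_ge0 ?subr_ge0 ?(ltW rho1)// mulr_ge0// ltW.
have intD e : (\int[P]_w layers (D e) c w <= M%:E)%E.
  apply: integral_layers_le => // m.
  apply: (@le_trans _ _ (\sum_(j < m) 121 * (eps2 / K2) * p * C1 * L * (2 * b) * rho ^+ j)); last first.
    rewrite -mulr_sumr /M [121 * (eps2 / K2) * p * C1 * L * (2 * b / _)]mulrA ler_wpM2l//.
    exact: sum_geometric_le.
  apply: ler_sum => j _.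
  have hD : fine (P (D e j)) <= 121 * (eps2 / K2) * (p * Fc (2 ^+ j * b)).
    apply: le_trans (prob_open_heavy_close e (d0 j)).
    apply: fine_le; [exact: fin_num_measure|exact/fin_num_measure/mG|].
    apply: (le_trans (measureU2 _ mN' (mG e j))).
    by rewrite [X in (X + _)%E]N'0 add0e.
  apply: (@le_trans _ _ (c j * (121 * (eps2 / K2) * (p * (C1 * (rho / 4) ^+ j * L))))).
    rewrite ler_wpM2l// (le_trans hD)// ler_wpM2l ?mulr_ge0 ?divr_ge0 ?eps2_ge0 ?(ltW K20)//.
    by rewrite ler_wpM2l.
  (* A first moment needs only 2^j, so a spare factor 2^(-j) remains and is bounded by 1. *)
  rewrite (_ : c j * _ = 121 * (eps2 / K2) * p * C1 * L * (2 * b) * (rho ^+ j * (2^-1) ^+ j)); last first.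
    have e4 : 4 = 2 * 2 :> R by lra.
    rewrite /c expr_div_n exprVn e4 exprMn exprS; field.
    by rewrite expf_neq0//= gt_eqF.
  rewrite ler_wpM2l//.
  by rewrite ler_piMr ?exprn_ge0 ?(ltW rho0)// exprn_ile1// ?invr_ge0// invf_le1// ler1n.
have mtau : measurable_fun setT (tau B r rule) by apply: measurable_tau.
rewrite unlock.
apply: (@le_trans _ _ (\int[P]_w ((n%:R * b)%:E + \sum_(e : edge n) layers (D e) c w))%E).
  apply: ge0_le_integral => //.
  - by move=> w _; rewrite lee_fin tau_ge0.
  - by apply/measurable_EFinP.
  - apply: emeasurable_funD => //; apply: emeasurable_sum => e; exact: measurable_layers.
  - move=> w _; have := tau_le_excess (B := B) r rule w (ltW b_gt0).
    rewrite -lee_fin => /le_trans; apply.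
    rewrite EFinD leeD2l// -sumEFin big_mkcond; apply: lee_sum => e _.
    case: ifP => [eE|_]; last exact: layers_ge0.
    case: ltP => [bW|_]; last exact: layers_ge0.
    have ex : exists j, edge_weight B e w <= 2 ^+ j * b.
      pose m := Num.truncn (edge_weight B e w / b).
      exists m.+1; rewrite -ler_pdivrMr//; apply: ltW.
      apply: lt_le_trans (truncnS_gt _) _.
      by rewrite -natrX ler_nat ltnW// ltn_expl.
    (* The least j with W <= 2^j b is positive because W > b; its predecessor indexes the layer that
       dominates W. *)
    case: (ex_minnP ex) => -[|j] hj jmin; first by rewrite expr0 mul1r leNgt bW in hj.
    have Wj : 2 ^+ j * b < edge_weight B e w.
      by rewrite ltNge; apply/negP => /jmin; rewrite ltnn.
    have Dj : D e j w.
      case: (pselect (in_square w)) => [sq|nsq]; last by left; apply: NN'.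
      right; rewrite /G /= Wj andbT.
      have := brgg_far (k := k) r0 Kr4 sq eE; rewrite inE !ffunE => ->.
      by move: eE; rewrite inE => /andP[].
    by apply: le_trans (layers_ge c0 Dj); rewrite lee_fin.
rewrite ge0_integralD//; last 3 first.
- by move=> w _; rewrite lee_fin mulr_ge0// ltW.
- by move=> w _; apply: sume_ge0 => e _; apply: layers_ge0.
- by apply: emeasurable_sum => e; exact: measurable_layers.
rewrite integral_cst// [X in (_ * X)%E](@probability_setT _ _ _ P) mule1 EFinD leeD2l//.
rewrite ge0_integral_sum//; last 2 first.
- by move=> e; apply: measurable_layers.
- by move=> e w _; apply: layers_ge0.
apply: (@le_trans _ _ (\sum_(e : edge n) M%:E)%E).
  by apply: lee_sum => e _; apply: intD.
rewrite sumEFin lee_fin sumr_const -[leLHS]mulr_natl -natrX ler_wpM2r// ler_nat.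
exact: card_edge_le.
Qed.

End UpperExpectation.

(** * Asymptotic scales *)

Lemma near_le_ln (R : realType) (c : R) : \forall n \near \oo, c <= ln (n%:R : R).
Proof.
exists (Num.truncn (expR c)).+1 => // n /= hn.
have en : expR c <= n%:R.
  by apply: le_trans (ltW (truncnS_gt _)) _; rewrite ler_nat.
by rewrite -[c]expRK ler_ln ?posrE ?expR_gt0// (lt_le_trans (expR_gt0 c) en).
Qed.

Section Scales.
Context {R : realType} (eps1 c r p : R) (n : nat).
Hypothesis c_gt0 : 0 < c.
(* Both exponential rates below are at least 5 c D, while ln n <= c D: the factor n^3 of
   the union bounds costs at most 3 c D. *)
Hypothesis c_le : 5 * c * (8 * 16) <= eps1.
Hypothesis r01 : 0 < r < 1.
Hypothesis p01 : 0 < p < 1.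
Local Notation D := (n%:R * r ^+ 2 * p).
Hypothesis ln_le : ln n%:R <= c * D.
Hypothesis D_ge : 8 * 16 <= D.

Definition grid_size : nat := Num.truncn (3 / r).
Local Notation k := grid_size.
Local Notation K2 := (#|{: cell k}|%:R : R).

Lemma degree_le_pairs : D <= n%:R * r ^+ 2.
Proof. by case/andP: p01 => p0 p1; rewrite ler_piMr ?(ltW p1)// mulr_ge0 ?sqr_ge0. Qed.

Lemma degree_le_size : D <= n%:R.
Proof.
apply: le_trans degree_le_pairs _; case/andP: r01 => r0 r1.
by rewrite ler_piMr// exprn_ile1// ltW.
Qed.

Lemma size_ge : 8 * 16 <= n%:R :> R.
Proof. exact: le_trans D_ge degree_le_size. Qed.

Lemma sizeR_gt0 : 0 < n%:R :> R.
Proof. by apply: lt_le_trans size_ge; rewrite mulr_gt0. Qed.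

Lemma size_gt0 : (0 < n)%N.
Proof. by rewrite -(ltr0n R) sizeR_gt0. Qed.

Lemma grid_size_bounds : 3 < k.+1%:R * r <= 4.
Proof.
case/andP: r01 => r0 r1; apply/andP; split.
  by rewrite -ltr_pdivrMr// /grid_size truncnS_gt.
have : k%:R <= 3 / r by rewrite truncn_le divr_ge0// ltW.
by rewrite ler_pdivlMr// -[k.+1%:R]natr1; lra.
Qed.

Lemma size_div_card_cell : n%:R * r ^+ 2 / 16 <= n%:R / K2 <= n%:R * r ^+ 2 / 9.
Proof.
have K20 := @card_cell_gt0 R k; case/andP: r01 => r0 _.
case/andP: grid_size_bounds => K3 K4.
have Kr : K2 * r ^+ 2 = (k.+1%:R * r) ^+ 2 by rewrite card_cellE exprMn.
have r20 : 0 < r ^+ 2 by rewrite exprn_gt0.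
have inv1 : r ^+ 2 / 16 <= K2^-1.
  rewrite -(ler_pM2r K20) mulVf ?gt_eqF// mulrAC [r ^+ 2 * K2]mulrC Kr.
  by rewrite ler_pdivrMr// mul1r; nra.
have inv2 : K2^-1 <= r ^+ 2 / 9.
  rewrite -(ler_pM2r K20) mulVf ?gt_eqF// mulrAC [r ^+ 2 * K2]mulrC Kr.
  by rewrite ler_pdivlMr// mul1r; nra.
by apply/andP; split; [rewrite -[leLHS]mulrA ler_wpM2l|rewrite -[leRHS]mulrA ler_wpM2l].
Qed.

Lemma card_cell_le_size : K2 <= n%:R.
Proof.
have K20 := @card_cell_gt0 R k; case/andP: size_div_card_cell => h _.
have : 8 <= n%:R / K2.
  by apply: le_trans h; rewrite ler_pdivlMr//; apply: le_trans D_ge degree_le_pairs.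
rewrite ler_pdivlMr// => h8; apply: le_trans h8; by rewrite ler_peMl ?(ltW K20)// ler1n.
Qed.

Local Notation y := (expR (- (c * D))).

Lemma size_mul_expRN_le1 : n%:R * y <= 1.
Proof.
have n0 := sizeR_gt0; rewrite -{1}[n%:R](lnK (R := R)) ?posrE//.
by rewrite -expRD -[leRHS]expR0 ler_expR subr_le0.
Qed.

Lemma expRN_le_exp m (t : R) : m%:R * (c * D) <= t -> expR (- t) <= y ^+ m.
Proof. by rewrite -expRM_natl ler_expR mulrN lerN2. Qed.

Lemma density_bound_gt0 : 0 < eps1.
Proof. by apply: lt_le_trans c_le; rewrite !mulr_gt0. Qed.

(** The rate is eps1 p n / (8 K2), and K <= 4/r bounds n / K2 below by n r^2 / 16; hence the factor
    8 * 16 in [c_le]. *)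
Lemma edge_rate : 5 * (c * D) <= p * (eps1 * n%:R / (4 * K2)) / 2.
Proof.
have K20 := @card_cell_gt0 R k; case/andP: size_div_card_cell => h _; case/andP: p01 => p0 p1.
have e0 := density_bound_gt0.
have -> : p * (eps1 * n%:R / (4 * K2)) / 2 = eps1 * (p * (n%:R / K2)) / 8.
  by field; rewrite gt_eqF.
have : D / 16 <= p * (n%:R / K2).
  have := ler_wpM2l (ltW p0) h; apply: le_trans.
  by rewrite [leRHS]mulrA [p * _]mulrC.
have D0 : 0 < D by apply: lt_le_trans D_ge; rewrite mulr_gt0.
move: D0; move: (D) (p * (n%:R / K2)) => d q d0 dq.
have := ler_wpM2l (ltW e0) dq; have := ler_wpM2r (ltW d0) c_le; lra.
Qed.

Lemma cell_rate : 5 * (c * D) <= eps1 * n%:R / (4 * K2).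
Proof.
apply: le_trans edge_rate _.
have K20 := @card_cell_gt0 R k; case/andP: p01 => p0 p1.
have q0 : 0 <= eps1 * n%:R / (4 * K2).
  by rewrite divr_ge0 ?mulr_ge0// ltW// density_bound_gt0.
move: (eps1 * _ / _) q0 => q q0; nra.
Qed.

Lemma edge_small : n%:R * expR (- (p * (eps1 * n%:R / (4 * K2)) / 2)) <= 2^-1.
Proof.
have y0 := expR_gt0 (- (c * D)); have n0 := sizeR_gt0; have nn := size_ge.
have ny := size_mul_expRN_le1; move: (expRN_le_exp edge_rate) => h.
apply: le_trans (ler_wpM2l (ltW n0) h) _.
move: (n%:R) (y) y0 n0 nn ny => m z z0 m0 mm mz.
have z1 : z * 2 <= 1 by nra.
rewrite exprS mulrA; apply: (@le_trans _ _ (1 * z ^+ 4)).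
  by rewrite ler_wpM2r ?exprn_ge0// ltW.
rewrite mul1r; apply: (@le_trans _ _ z); last by lra.
by rewrite ler_iXnr//; lra.
Qed.

Lemma disconnect_bound_le : disconnect_bound eps1 n p k <= y.
Proof.
have y0 := expR_gt0 (- (c * D)); have n0 := sizeR_gt0; have nn := size_ge.
have ny := size_mul_expRN_le1; move: (expRN_le_exp edge_rate) (expRN_le_exp cell_rate) => h1 h2.
have K20 := @card_cell_gt0 R k; have Kn := card_cell_le_size.
rewrite /disconnect_bound /=.
have {}h1 := le_trans h1 (_ : y ^+ 5 <= y ^+ 5); have {}h2 := le_trans h2 (_ : y ^+ 5 <= y ^+ 5).
move: (h1 (lexx _)) (h2 (lexx _)) => {h1 h2}.
move: (expR (- (p * _ / 2))) (expR (- (eps1 * _ / _))) (expR (- (c * D))) y0 ny => z1 z2 w y0 ny h1 h2.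
move: (K2) (n%:R) K20 Kn n0 nn ny => q m q0 qm m0 mm mw.
have w1 : w * 8 <= 1 by nra.
have w5 : 0 <= w ^+ 5 by rewrite exprn_ge0// ltW.
have b1 : q * z2 <= m * w ^+ 5.
  by apply: le_trans (ler_wpM2l (ltW q0) h2) _; rewrite ler_wpM2r.
have b2 : q ^+ 2 * (2 * m * z1) <= m ^+ 2 * (2 * m * w ^+ 5).
  apply: (@le_trans _ _ (q ^+ 2 * (2 * m * w ^+ 5))).
    by rewrite ler_wpM2l ?sqr_ge0// ler_wpM2l// mulr_ge0// ltW.
  apply: ler_wpM2r; first by rewrite mulr_ge0// mulr_ge0// ltW.
  by rewrite lerXn2r ?nnegrE ?(ltW q0) ?(ltW m0).
apply: (le_trans (lerD b1 b2)).
(* Each factor n is paired with one w, and n w <= 1. The leftover w^4 and w^2 are at most w/8, as w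
   <= 1/8. *)
have -> : m * w ^+ 5 + m ^+ 2 * (2 * m * w ^+ 5) =
  (m * w) * (w ^+ 4) + 2 * (m * w) ^+ 3 * w ^+ 2 by ring.
have mw0 : 0 <= m * w by rewrite mulr_ge0// ltW.
have mw3 : (m * w) ^+ 3 <= 1 by rewrite exprn_ile1.
have w2 : w ^+ 2 <= w / 8 by rewrite expr2; nra.
have w4 : w ^+ 4 <= w / 8.
  apply: le_trans w2; rewrite -[leRHS]mulr1 (exprD w 2 2) ler_wpM2l ?sqr_ge0//.
  by rewrite exprn_ile1 ?(ltW y0)//; lra.
have w20 := sqr_ge0 w.
have t1 : m * w * w ^+ 4 <= w / 8 by apply: le_trans w4; rewrite ler_piMl// exprn_ge0// ltW.
have t2 : 2 * (m * w) ^+ 3 * w ^+ 2 <= 2 * (w / 8).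
  rewrite -mulrA ler_wpM2l//; apply: le_trans w2; rewrite ler_piMl//.
lra.
Qed.

End Scales.

(** * Lower bounds with explicit constants *)

Section TauLowerBounds.
Context {R : realType} (f : plane R -> R) (Fc : R -> R) (eps1 eps2 : R).
Hypothesis eps1_gt0 : 0 < eps1.
Hypothesis f_density : square_density f.
Hypothesis f_bounds : forall x, unit_square R x -> eps1 <= f x <= eps2.
Hypothesis Fc_ccdf : is_positive_ccdf Fc.
Context {n : nat} {r p : R}.
Hypothesis r01 : 0 < r < 1.
Hypothesis p01 : 0 < p < 1.
Variables (B : brgg_space f Fc n p).
Local Notation P := (prob B).
Variable rule : forall n : nat, {set edge n} -> {set 'I_n}.
Hypothesis rule_ok : tie_breaking_rule rule.
Variable c : R.
Hypothesis c_gt0 : 0 < c.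
Hypothesis c_le : 5 * c * (8 * 16) <= eps1.
Local Notation D := (n%:R * r ^+ 2 * p).
Hypothesis ln_le : ln n%:R <= c * D.

(** The conditions on g1 make the connectivity error and the sparsity error each at most y1^2 with
    y1 = e^(-g1 D). From g1 D >= 2 follow both H(g1 D) > 0 and y1 <= 1/2, so that 2 y1^2 <= y1. *)
Lemma tau_lower_bounds (g1 : R) : 0 < g1 -> g1 * 2 <= c -> g1 * (8 * 8 * 16) <= 1 ->
  2 <= g1 * D ->
  ((1 - expR (- (g1 * D)))%:E <=
     P (E_con B r `&` [set w | (g1 * n%:R * H Fc (g1 * D) <= tau B r rule w)%R]))%E /\
  ((g1 * n%:R * H Fc (g1 * D))%:E <= 'E_P[tau B r rule])%E.
Proof.
move=> g0 g_c g_small g1D; case/andP: (r01) => r0 r1; case/andP: (p01) => p0 p1.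
have D_ge : 8 * 16 <= D.
  rewrite -(ler_pM2l g0); apply: le_trans g1D; move: g_small; lra.
have D0 : 0 < D by apply: lt_le_trans D_ge; rewrite mulr_gt0.
have gD0 : 0 < g1 * D by rewrite mulr_gt0.
have n0 := size_gt0 r01 p01 D_ge; have n0R := sizeR_gt0 r01 p01 D_ge.
have Dn := degree_le_size n r01 p01.
have X128 : 8 * 16 <= n%:R * r ^+ 2 := le_trans D_ge (degree_le_pairs _ _ p01).
set h := H Fc (g1 * D).
have h0 : 0 < h.
  have [x x0 xh] := ccdf_half Fc_ccdf; apply: (lt_le_trans x0); apply: le_H => //.
  by apply: le_trans xh; rewrite lef_pV2 ?posrE.
have hF := ccdf_H_half Fc_ccdf gD0 h0; rewrite -/h in hF.
pose k := grid_size r.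
have K20 := @card_cell_gt0 R k.
case/andP: (size_div_card_cell n r01) => nK _.
case/andP: (grid_size_bounds r01) => K3 _.
have small := edge_small c_gt0 c_le r01 p01 ln_le D_ge.
have disc := disconnect_bound_le c_gt0 c_le r01 p01 ln_le D_ge.
have heavy : expR (n%:R - p * Fc (h / 2) * (n%:R ^+ 2 / (8 * #|{: cell k}|%:R) - n%:R / 2)) <=
    expR (- (2 * (g1 * D))).
  rewrite ler_expR.
  set X := n%:R * r ^+ 2 in X128 nK *.
  have X0 : 0 < X by apply: lt_le_trans X128; rewrite mulr_gt0.
  set q := p * Fc (h / 2); set m := _ - n%:R / 2.
  have qX : (g1 * X)^-1 <= q.
    rewrite /q -ler_pdivrMl//; apply: le_trans hF; rewrite -invfM.
    by rewrite (_ : p * (g1 * X) = g1 * D)// /X; ring.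
  have mX : n%:R * X / (16 * 16) <= m.
    have -> : m = n%:R * (n%:R / #|{: cell k}|%:R) / 8 - n%:R / 2.
      by rewrite /m; field; rewrite gt_eqF.
    have h1 := ler_wpM2l (ltW n0R) nK; have h2 := ler_wpM2l (ltW n0R) X128.
    by move: h1 h2; lra.
  (* Here p has cancelled from q >= 1/(g1 X), and m >= n X / 256, so q m >= n / (256 g1). The
     exponent is then at most n - 4n <= -2n <= -2 g1 D. *)
  have qm : 4 * n%:R <= q * m.
    apply: (@le_trans _ _ ((g1 * X)^-1 * (n%:R * X / (16 * 16)))); last first.
      by apply: ler_pM => //; [rewrite invr_ge0 mulr_ge0// ltW|rewrite divr_ge0// mulr_ge0// ltW].
    rewrite (_ : _ * (_ / _) = n%:R / (g1 * (16 * 16))); last first.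
      by field; rewrite gt_eqF// gt_eqF.
    rewrite ler_pdivlMr ?mulr_gt0//.
    by have := ler_wpM2l (ltW n0R) g_small; lra.
  have : g1 * D <= n%:R.
    apply: le_trans Dn; rewrite ler_piMl ?(ltW D0)//; move: g_small; lra.
  move=> gn; apply: (@le_trans _ _ (- (2 * n%:R))); last by rewrite lerN2 ler_wpM2l.
  by move: (q * m) qm n0R => u; move: (n%:R : R) => v hv v0; lra.
set y1 := expR (- (g1 * D)).
have y10 : 0 < y1 := expR_gt0 _.
have y1_half : y1 * 2 <= 1.
  have := expR_ge1Dx (g1 * D); have : y1 * expR (g1 * D) = 1 by rewrite -expRD addNr expR0.
  by move: (expR (g1 * D)) => e; nra.
have y2 : expR (- (2 * (g1 * D))) = y1 ^+ 2 by rewrite -expRM_natl mulrN.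
have total : disconnect_bound eps1 n p k +
    expR (n%:R - p * Fc (h / 2) * (n%:R ^+ 2 / (8 * #|{: cell k}|%:R) - n%:R / 2)) <= y1.
  have d2 : disconnect_bound eps1 n p k <= expR (- (2 * (g1 * D))).
    apply: le_trans disc _; rewrite ler_expR lerN2 mulrA ler_wpM2r ?(ltW D0)//.
    by rewrite mulrC.
  apply: (le_trans (lerD d2 heavy)); rewrite y2; nra.
have h20 : 0 < h / 2 by rewrite divr_gt0.
have main := prob_tau_ge eps1_gt0 f_density f_bounds p01 Fc_ccdf B rule_ok n0 r0 K3 h20 small.
have {}main : ((1 - y1)%:E <= P (E_con B r `&` [set w | (n%:R * (h / 2) / 4 <= tau B r rule w)%R]))%E.
  by apply: le_trans main; rewrite lee_fin lerD2l lerN2.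
have nh0 : 0 < n%:R * h by rewrite mulr_gt0.
(* The tree weighs n h / 8, and the expectation loses a further factor 1 - y1 >= 1/2. *)
have g8 : g1 * n%:R * h * 16 <= n%:R * h.
  by have := ler_wpM2l (ltW nh0) g_small; nra.
split.
  apply: (le_trans main); rewrite le_measure ?inE//.
  - by apply: measurableI; [apply: measurable_E_con|apply: measurable_tau_ge].
  - by apply: measurableI; [apply: measurable_E_con|apply: measurable_tau_ge].
  - by move=> w [Ew /= tw]; split => //=; apply: le_trans tw; move: g8 nh0; lra.
apply: le_trans (expectation_ge_prob (t := n%:R * (h / 2) / 4) _ _ _ _ _ main); first last.
- by move=> w [].
- by move: nh0; lra.
- by apply: measurableI; [apply: measurable_E_con|apply: measurable_tau_ge].
- by move=> w; apply: tau_ge0.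
- exact: measurable_tau.
rewrite lee_fin (_ : n%:R * (h / 2) / 4 = n%:R * h / 8); last by field.
have := ler_wpM2l (ltW nh0) y1_half; move: g8; lra.
Qed.

End TauLowerBounds.

(** Both z and y^(1/4) are at most the square root of n. The exponent 1/4 leaves room for an
    arbitrary constant z in an error z/n. *)
Lemma powR_quarter_le (R : realType) (n z y : R) : 0 < n -> 0 < z -> 0 < y ->
  y <= n ^+ 2 -> z ^+ 2 <= n -> z / n <= 1 / y `^ 4^-1.
Proof.
move=> n0 z0 y0 yn zn; set q := y `^ 4^-1.
have q0 : 0 < q by apply: powR_gt0.
have q4 : q ^+ 4 = y.
  rewrite -powR_mulrn ?powR_ge0// -powRrM mulVf ?pnatr_eq0// powRr1 //.
  exact: ltW.
have q2 : q ^+ 2 <= n.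
  rewrite -(@ler_pXn2r _ 2) ?nnegrE ?sqr_ge0 ?(ltW n0)//.
  by rewrite -exprM q4.
rewrite ler_pdivrMr// mulrAC ler_pdivlMr// mul1r.
rewrite -(@ler_pXn2r _ 2) ?nnegrE ?mulr_ge0 ?(ltW q0) ?(ltW z0) ?(ltW n0)//.
by rewrite exprMn expr2 ler_pM ?sqr_ge0.
Qed.

(** * Upper bounds with explicit constants *)

Section TauUpperBounds.
Context {R : realType} (f : plane R -> R) (Fc : R -> R) (eps1 eps2 : R).
Hypothesis eps1_gt0 : 0 < eps1.
Hypothesis eps12 : eps1 <= eps2.
Hypothesis f_density : square_density f.
Hypothesis f_bounds : forall x, unit_square R x -> eps1 <= f x <= eps2.
Hypothesis Fc_ccdf : is_positive_ccdf Fc.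
Context {n : nat} {r p : R}.
Hypothesis r01 : 0 < r < 1.
Hypothesis p01 : 0 < p < 1.
Variables (B : brgg_space f Fc n p).
Local Notation P := (prob B).
Variable rule : forall n : nat, {set edge n} -> {set 'I_n}.
Variable c : R.
Hypothesis c_gt0 : 0 < c.
Hypothesis c_le : 5 * c * (8 * 16) <= eps1.
Local Notation D := (n%:R * r ^+ 2 * p).
Hypothesis ln_le : ln n%:R <= c * D.
Hypothesis D_ge : 8 * 16 <= D.
Variables (C1 rho x0 x1 A : R).
Hypothesis C1_ge0 : 0 <= C1.
Hypothesis rho01 : 0 < rho < 1.
Hypothesis tailF : forall b j, x0 < b -> Fc (2 ^+ j * b) <= C1 * (rho / 4) ^+ j * Fc b.
Hypothesis x1_gt0 : 0 < x1.
Hypothesis x1_half : 2^-1 <= Fc x1.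
Hypothesis A_ge2 : 2 <= A.
Hypothesis A_x1 : x0 < A * x1.

(* 11 * 11 bounds the number of cells that are close 5 to a given one. *)
Definition edge_const : R := 11 * 11 * 16 * eps2 * C1 / (1 - rho).
Local Notation Q := edge_const.

(** The threshold is b = A h: A >= 2 puts it above h, and [A_x1] puts it above x0. The weight bound
    is n b from the forest, Q n b from the mean excess and n b from the deviation v. The four errors
    1/n, 1/n, C1/n and Q/n add up to (2 + C1 + Q)/n. *)
Lemma tau_upper_bounds (g2 : R) : (2 + Q) * A <= g2 -> (2 + C1 + Q) ^+ 2 <= n%:R ->
  ((1 - 1 / ((n%:R ^+ 2 * r ^+ 2 * p) `^ 4^-1))%:E <=
     P (E_con B r `&` [set w | (tau B r rule w <= g2 * n%:R * H Fc D)%R]))%E /\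
  ('E_P[tau B r rule] <= (g2 * n%:R * H Fc D)%:E)%E.
Proof.
move=> g2_ge Zn; case/andP: (r01) => r0 r1; case/andP: (p01) => p0 p1.
have /andP[rho0 rho1] := rho01.
have D0 : 0 < D by apply: lt_le_trans D_ge; rewrite mulr_gt0.
have n0 := size_gt0 r01 p01 D_ge; have n0R := sizeR_gt0 r01 p01 D_ge.
have Dn := degree_le_size n r01 p01.
have n8 := size_ge r01 p01 D_ge.
have eps20 : 0 < eps2 := lt_le_trans eps1_gt0 eps12.
have r'0 : 0 < 1 - rho by rewrite subr_gt0.
set X := n%:R * r ^+ 2.
have X0 : 0 < X by rewrite mulr_gt0// exprn_gt0.
set h := H Fc D.
have h_ge : x1 <= h.
  apply: le_H => //; apply: le_trans x1_half; rewrite lef_pV2 ?posrE//.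
  by apply: le_trans D_ge; rewrite -natrM ler_nat.
have h0 : 0 < h := lt_le_trans x1_gt0 h_ge.
pose b := A * h.
have A0 : 0 < A by apply: lt_le_trans A_ge2.
have b0 : 0 < b by rewrite mulr_gt0.
have x0b : x0 < b by apply: (lt_le_trans A_x1); rewrite ler_wpM2l// ltW.
have hb : h < b by rewrite /b; have := ler_wpM2r (ltW h0) A_ge2; move: h0; lra.
have Fb : Fc b <= D^-1 by apply: ltW; apply: ccdf_gt_H.
have L0 : 0 <= D^-1 by rewrite invr_ge0 ltW.
have tail j : Fc (2 ^+ j * b) <= C1 * (rho / 4) ^+ j * D^-1.
  by apply: le_trans (tailF _ x0b) _; rewrite ler_wpM2l// mulr_ge0// exprn_ge0// divr_ge0// ltW.
pose k := grid_size r.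
have K20 := @card_cell_gt0 R k.
set K2 : R := #|{: cell k}|%:R in K20.
have nK : n%:R / K2 <= X.
  case/andP: (size_div_card_cell n r01) => _ /le_trans; apply.
  by rewrite ler_pdivrMr// ler_peMr ?(ltW X0)// ler1n.
have Kbnd := grid_size_bounds r01.
have /andP[_ K4] := Kbnd.
have small := edge_small c_gt0 c_le r01 p01 ln_le D_ge.
have disc := disconnect_bound_le c_gt0 c_le r01 p01 ln_le D_ge.
have ny := size_mul_expRN_le1 r01 p01 ln_le D_ge.
have y0 := expR_gt0 (- (c * D)).
have yn : expR (- (c * D)) <= n%:R^-1 by rewrite -[leRHS]mulr1 ler_pdivlMl.
have Q0 : 0 <= Q.
  rewrite /edge_const divr_ge0 ?(ltW r'0)// mulr_ge0// mulr_ge0 ?(ltW eps20)//.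
have nb0 : 0 < n%:R * b by rewrite mulr_gt0.
have DX : D = X * p by [].
set far : R := n%:R * (121 * (4 * eps2 * n%:R / K2)).
(* Since D = X p, the factor p/D is 1/X and cancels against n / K2 <= X. *)
have far_s (u : R) : 0 <= u -> far * (p * (4 * C1 * D^-1 * u / (1 - rho))) <= Q * (n%:R * u).
  move=> u0.
  have -> : far * (p * (4 * C1 * D^-1 * u / (1 - rho))) =
     (n%:R / K2) * (Q * (n%:R * u) / X).
    by rewrite /far /edge_const DX; field; rewrite !gt_eqF.
  apply: (le_trans (ler_wpM2r _ nK)).
    by rewrite divr_ge0 ?(ltW X0)// mulr_ge0// mulr_ge0// ltW.
  by rewrite mulrC divfK ?gt_eqF.
have tau_bound : n%:R * b + (far * (p * (4 * C1 * D^-1 * b / (1 - rho))) + n%:R * b) <=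
    g2 * n%:R * h.
  apply: (@le_trans _ _ ((2 + Q) * A * (n%:R * h))); last first.
    by rewrite -[leRHS]mulrA ler_wpM2r// mulr_ge0// ltW.
  by have := far_s b (ltW b0); rewrite /b; lra.
have K2n : K2 <= n%:R := card_cell_le_size r01 p01 D_ge.
have crowd : K2 * expR (- (eps2 * n%:R / K2)) <= n%:R^-1.
  have h1 : expR (- (eps2 * n%:R / K2)) <= expR (- (c * D)) ^+ 2.
    apply: expRN_le_exp; apply: (@le_trans _ _ (5 * (c * D))).
      by apply: ler_wpM2r; [apply: mulr_ge0; apply: ltW|rewrite ler_nat].
    apply: le_trans (cell_rate c_gt0 c_le r01 p01 D_ge) _.
    rewrite -/K2 invfM mulrA ler_wpM2r ?invr_ge0 ?(ltW K20)//.
    rewrite ler_pdivrMr//; have := ler_wpM2r (ltW n0R) eps12.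
    by have := mulr_gt0 eps20 n0R; lra.
  apply: (@le_trans _ _ (n%:R * expR (- (c * D)) ^+ 2)).
    by rewrite ler_pM ?expR_ge0// ltW.
  rewrite expr2 mulrA; apply: le_trans yn.
  by rewrite ler_piMl// ltW.
(* With J = 2n + 1 the power is at most 4^(-2n) = (2^(-n))^4 <= n^(-4), which beats the n^2
   edges. *)
have top : n%:R ^+ 2 * (C1 * (rho / 4) ^+ ((2 * n).+1).-1 * D^-1) <= C1 / n%:R.
  have q1 : (rho / 4) ^+ (2 * n) <= n%:R^-1 ^+ 4.
    apply: (@le_trans _ _ (4^-1 ^+ (2 * n))).
      by rewrite lerXn2r ?nnegrE ?divr_ge0 ?(ltW rho0)// ler_piMl// ltW.
    have e4 : 4^-1 = (2^-1) ^+ 2 :> R by field.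
    have -> : 4^-1 ^+ (2 * n) = (2^-1 ^+ n) ^+ 4 :> R.
      by rewrite e4 -!exprM mulnA mulnC.
    rewrite lerXn2r ?nnegrE ?exprn_ge0 ?invr_ge0// exprVn lef_pV2 ?posrE ?exprn_gt0//.
    by rewrite -natrX ler_nat ltnW// ltn_expl.
  have D1 : D^-1 <= 1.
    by rewrite invf_le1//; apply: le_trans D_ge; rewrite -natrM ler1n.
  apply: (@le_trans _ _ (n%:R ^+ 2 * (C1 * n%:R^-1 ^+ 4 * 1))).
    rewrite ler_wpM2l ?sqr_ge0//; apply: ler_pM => //.
      by rewrite mulr_ge0// exprn_ge0// divr_ge0// ltW.
    by rewrite ler_wpM2l.
  have -> : n%:R ^+ 2 * (C1 * n%:R^-1 ^+ 4 * 1) = C1 / n%:R * n%:R^-1.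
    by field; rewrite gt_eqF.
  rewrite ler_piMr ?divr_ge0 ?(ltW n0R)// invf_le1//.
  by apply: le_trans n8; rewrite -natrM ler1n.
have cheb : far * (p * (4 * C1 * D^-1 * b ^+ 2 / (1 - rho))) / (n%:R * b) ^+ 2 <= Q / n%:R.
  rewrite ler_pdivrMr ?exprn_gt0//; apply: le_trans (far_s _ (sqr_ge0 b)) _.
  by rewrite (_ : Q / n%:R * (n%:R * b) ^+ 2 = Q * (n%:R * b ^+ 2))//; field; rewrite gt_eqF.
have nD0 : 0 < n%:R ^+ 2 * r ^+ 2 * p by rewrite !mulr_gt0 ?exprn_gt0.
split.
  have main := prob_tau_le eps1_gt0 f_density f_bounds p01 B b0 rho01 C1_ge0 L0 tail
    (ltn0Sn (2 * n)) rule n0 r0 Kbnd nb0 small.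
  apply: (@le_trans _ _ (1 - (2 + C1 + Q) / n%:R)%:E).
    rewrite lee_fin lerD2l lerN2; apply: powR_quarter_le => //.
      by rewrite ltr_wpDr// ltr_wpDr.
    rewrite (_ : n%:R ^+ 2 * r ^+ 2 * p = n%:R * D); last by ring.
    by rewrite expr2 ler_wpM2l// ltW.
  apply: le_trans (le_trans main _).
    rewrite lee_fin lerD2l lerN2.
    have -> : (2 + C1 + Q) / n%:R = n%:R^-1 + n%:R^-1 + C1 / n%:R + Q / n%:R by field; rewrite gt_eqF.
    by apply: lerD cheb; apply: lerD top; apply: lerD crowd; apply: le_trans disc yn.
  rewrite le_measure ?inE//.
  - by apply: measurableI; [apply: measurable_E_con|apply: measurable_tau_le].
  - by apply: measurableI; [apply: measurable_E_con|apply: measurable_tau_le].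
  - by move=> w [Ew /= tw]; split => //=; apply: le_trans tau_bound.
apply: le_trans (expectation_tau_le eps1_gt0 f_density f_bounds p01 Fc_ccdf B b0 rho01 C1_ge0 L0 tail rule r0 K4) _.
rewrite lee_fin; apply: le_trans tau_bound; rewrite lerD2l.
rewrite -/k -/K2.
have e20 : 0 <= C1 * D^-1 * b / (1 - rho).
  by rewrite divr_ge0 ?(ltW r'0)// mulr_ge0 ?(ltW b0)// mulr_ge0.
apply: (@le_trans _ _ (far * (p * (4 * C1 * D^-1 * b / (1 - rho))))); last first.
  by rewrite lerDl ltW.
have -> : n%:R ^+ 2 * (121 * (eps2 / K2) * p * C1 * D^-1 * (2 * b / (1 - rho))) =
  n%:R * (121 * (eps2 * n%:R / K2)) * (p * (C1 * D^-1 * b / (1 - rho))) * 2.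
  by field; rewrite !gt_eqF.
have -> : far * (p * (4 * C1 * D^-1 * b / (1 - rho))) =
  n%:R * (121 * (eps2 * n%:R / K2)) * (p * (C1 * D^-1 * b / (1 - rho))) * (4 * 4).
  by rewrite /far; field; rewrite !gt_eqF.
rewrite ler_wpM2l//; last by rewrite -natrM ler_nat.
rewrite mulr_ge0//; last by rewrite mulr_ge0// ltW.
by rewrite !mulr_ge0 ?invr_ge0 ?(ltW eps20) ?(ltW K20).
Qed.

End TauUpperBounds.

Theorem theorem1 (R : realType) (eps1 eps2 : R) (f : plane R -> R) (Fc : R -> R)
  (eps1_gt0 : 0 < eps1) (eps12 : eps1 <= eps2)
  (f_density : square_density f)
  (f_bounds : forall x, unit_square R x -> eps1 <= f x <= eps2)
  (Fc_ccdf : is_positive_ccdf Fc) :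
  (exists g0 g1 : R, [/\ 0 < g0, 0 < g1 &
     forall (M : R) (r p : nat -> R)
       (B : forall n : nat, brgg_space f Fc n (p n))
       (rule : forall n : nat, {set edge n} -> {set 'I_n}),
     g0 < M ->
     (forall n, 0 < r n < 1) -> (forall n, 0 < p n < 1) ->
     (\forall n \near \oo, M * ln n%:R <= n%:R * r n ^+ 2 * p n) ->
     tie_breaking_rule rule ->
     \forall n \near \oo,
       ((1 - expR (- (g1 * n%:R * r n ^+ 2 * p n)))%:E <=
         prob (B n) (E_con (B n) (r n) `&`
           [set w | (g1 * n%:R * H Fc (g1 * n%:R * r n ^+ 2 * p n) <=
                     tau (B n) (r n) rule w)%R]))%E /\
       ((g1 * n%:R * H Fc (g1 * n%:R * r n ^+ 2 * p n))%:E <=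
         'E_(prob (B n))[tau (B n) (r n) rule])%E])
  /\
  (forall C x0 s : R, 0 < C -> 0 < x0 -> 2 < s ->
     (forall a x : R, 1 < a -> x0 < x -> Fc (a * x) <= C / (a `^ s) * Fc x) ->
   exists g2 g3 : R, [/\ 0 < g2, 0 < g3 &
     forall (M : R) (r p : nat -> R)
       (B : forall n : nat, brgg_space f Fc n (p n))
       (rule : forall n : nat, {set edge n} -> {set 'I_n}),
     g2 < M ->
     (forall n, 0 < r n < 1) -> (forall n, 0 < p n < 1) ->
     (\forall n \near \oo, M * ln n%:R <= n%:R * r n ^+ 2 * p n) ->
     tie_breaking_rule rule ->
     \forall n \near \oo,
       ((1 - 1 / ((n%:R ^+ 2 * r n ^+ 2 * p n) `^ g3))%:E <=
         prob (B n) (E_con (B n) (r n) `&`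
           [set w | (tau (B n) (r n) rule w <=
                     g2 * n%:R * H Fc (n%:R * r n ^+ 2 * p n))%R]))%E /\
       ('E_(prob (B n))[tau (B n) (r n) rule] <=
         (g2 * n%:R * H Fc (n%:R * r n ^+ 2 * p n))%:E)%E]).
Proof.
(* The largest value that [c_le] admits. Any M > 1/c then gives ln n <= c D. *)
set c := eps1 / (5 * (8 * 16)).
have k0 : 0 < 5 * (8 * 16) :> R by rewrite -!natrM ltr0n.
have c0 : 0 < c by rewrite divr_gt0.
have c_le : 5 * c * (8 * 16) <= eps1.
  by rewrite mulrAC mulrC /c divfK// gt_eqF.
have ln_le (M d l : R) : c^-1 < M -> 0 <= l -> M * l <= d -> l <= c * d.
  move=> cM l0 Ml; apply: (@le_trans _ _ (c * (M * l))); last by rewrite ler_wpM2l// ltW.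
  by rewrite mulrA ler_peMl// -ler_pdivrMl// mulr1 ltW.
split.
- set g1 := Num.min (c / 2) (8 * 8 * 16)^-1.
  have k1 : 0 < 8 * 8 * 16 :> R by rewrite -!natrM ltr0n.
  have g0 : 0 < g1 by rewrite lt_min divr_gt0//= invr_gt0.
  have g_c : g1 * 2 <= c by rewrite -ler_pdivlMr// ge_min lexx.
  have g_small : g1 * (8 * 8 * 16) <= 1 by rewrite -ler_pdivlMr// mul1r ge_min lexx orbT.
  exists c^-1, g1; split => //; first by rewrite invr_gt0.
  move=> M r p B rule cM r01 p01 hD rule_ok.
  have M0 : 0 < M by apply: lt_trans cM; rewrite invr_gt0.
  (* Chosen so that g1 D >= g1 M ln n >= 2. *)
  have hln := @near_le_ln R (2 / g1 / M).
  apply: filterS2 hD hln => n hD hln.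
  have l0 : 0 <= ln (n%:R : R) by apply: le_trans hln; rewrite !divr_ge0// ltW.
  have gD : 2 <= g1 * (n%:R * r n ^+ 2 * p n).
    rewrite -ler_pdivrMl// [leLHS]mulrC; apply: le_trans hD.
    by rewrite -ler_pdivrMl// [leLHS]mulrC.
  have := tau_lower_bounds eps1_gt0 f_density f_bounds Fc_ccdf (r01 n) (p01 n) (B n) rule_ok
    c0 c_le (ln_le _ _ _ cM l0 hD) g0 g_c g_small gD.
  by rewrite !mulrA.
- move=> C x0 s C0 x00 s2 hF.
  have [rho rho01 tail] := ccdf_geometric Fc_ccdf C0 x00 s2 hF.
  have [x1 x10 x1h] := ccdf_half Fc_ccdf.
  set A := 2 + x0 / x1.
  have A2 : 2 <= A by rewrite lerDl divr_ge0// ltW.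
  have Ax1 : x0 < A * x1 by rewrite mulrDl divfK ?gt_eqF// ltrDr mulr_gt0.
  set Q := edge_const eps2 (C + 1) rho.
  have eps20 : 0 < eps2 := lt_le_trans eps1_gt0 eps12.
  have C10 : 0 <= C + 1 by rewrite addr_ge0// ltW.
  have Q0 : 0 <= Q.
    case/andP: rho01 => _ r1.
    by rewrite /Q /edge_const divr_ge0 ?subr_ge0 ?(ltW r1)// mulr_ge0// mulr_ge0 ?(ltW eps20).
  have QA : 0 <= (2 + Q) * A.
    by apply: mulr_ge0; [apply: addr_ge0|apply: le_trans A2].
  have g20 : 0 < (2 + Q) * A + c^-1 by rewrite ltr_wpDl// invr_gt0.
  (* The first constant has two roles: [(2 + Q) * A] is required by the weight bound, and the
     summand [c^-1] by the condition on M. *)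
  exists ((2 + Q) * A + c^-1), 4^-1; split => //.
  move=> M r p B rule gM r01 p01 hD rule_ok.
  have cM : c^-1 < M by apply: le_lt_trans gM; rewrite lerDr.
  have M0 : 0 < M by apply: lt_trans cM; rewrite invr_gt0.
  have hln := @near_le_ln R (8 * 16 / M).
  have hZ := @near_le_ln R ((2 + (C + 1) + Q) ^+ 2).
  apply: filterS3 hD hln hZ => n hD hln hZ.
  (* At n = 0 the logarithm is 0 by convention, which contradicts the positive lower bound in
     [hZ]. *)
  have n0 : 0 < n%:R :> R.
    rewrite ltNge; apply/negP => n0; move: hZ; rewrite ln0// leNgt exprn_gt0//.
    by rewrite ltr_wpDr// ltr_wpDr.
  have l0 : 0 <= ln (n%:R : R) by apply: le_trans hZ; rewrite sqr_ge0.
  have D_ge : 8 * 16 <= n%:R * r n ^+ 2 * p n.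
    by apply: le_trans hD; rewrite -ler_pdivrMl// [leLHS]mulrC.
  have Zn : (2 + (C + 1) + Q) ^+ 2 <= n%:R.
    apply: (le_trans hZ); rewrite -[leRHS](lnK (R := R)) ?posrE//.
    by apply: le_trans (expR_ge1Dx _); rewrite lerDr.
  have := tau_upper_bounds eps1_gt0 eps12 f_density f_bounds Fc_ccdf (r01 n) (p01 n) (B n) rule
    c0 c_le (ln_le _ _ _ cM l0 hD) D_ge C10 rho01 tail x10 x1h A2 Ax1 _ Zn.
  by apply; rewrite lerDl invr_ge0 ltW.
Qed.
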